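(* Let $\mathcal B$ and $\mathcal B'$ be ultracategories (in Lurie's sense) whose colax associators are invertible, regarded also as generalised ultracategories via $\mathrm{Hom}(A,\int_I M_i\,d\mu):=$ the set of morphisms $A\to\int_I M_i\,d\mu$ in the ultracategory, with the canonical structure maps $\beta,\Xi,\kappa$. Then there is an isomorphism of categories between the category of left ultrafunctors from $\mathcal B$ to $\mathcal B'$ as ordinary ultracategories (in Lurie's sense) and the category of left ultrafunctors from $\mathcal B$ to $\mathcal B'$ as generalised ultracategories.
   Context: **Ultrafilters.** $f\mu$ is the pushforward of an ultrafilter $\mu$ along a map $f$; $\delta_s$ is the principal ultrafilter at $s$; for ultrafilters $\nu_s$ on $T$ ($s\in S$) and $\mu$ on $S$, $\int_S\nu_s\,d\mu=\{U\subseteq T:\{s:U\in\nu_s\}\in\mu\}$. $\iota_i:X_i\to\coprod_I X_i$ are the inclusions. For sets $S_i$, $\int_I S_i\,d\mu=\varinjlim_{U\in\mu}\prod_{i\in U}S_i$, with elements written $[s_i]$. The symbol $*$ denotes the one-point set and its unique ultrafilter. **Ultracategory (Lurie).** A category $\mathcal A$ with: functors $\int_I(-)\,d\mu:\mathcal A^I\to\mathcal A$ for every set $I$ and ultrafilter $\mu$ on $I$; natural isomorphisms $\epsilon_{I,i_0}:\int_I M_i\,d\delta_{i_0}\to M_{i_0}$; natural maps $\Delta_{\mu,\nu_\bullet}:\int_T M_t\,d(\int_S\nu_s d\mu)\to\int_S\int_T M_t\,d\nu_s\,d\mu$; such that (A) $\Delta_{\delta_{s_0},\nu_\bullet}$ is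 inverse to $\epsilon_{S,s_0}$; (B) for every injection $f:S\to T$, $\Delta_{\mu,\delta_{f(\bullet)}}$ is an isomorphism; (C) for ultrafilters $\lambda$ on $R$, $\mu_r$ on $S$, $\nu_s$ on $T$: $(\int_R\Delta_{\mu_r,\nu_\bullet}d\lambda)\circ\Delta_{\lambda,\int_S\nu_s d\mu_\bullet}=\Delta_{\lambda,\mu_\bullet}\circ\Delta_{\int_R\mu_r d\lambda,\nu_\bullet}$. For $f:S\to T$ the ultraproduct diagonal map is $\Delta_{\mu,f}:=(\int_S\epsilon_{T,f(s)}d\mu)\circ\Delta_{\mu,\delta_{f(\bullet)}}:\int_T M_t\,d(f\mu)\to\int_S M_{f(s)}\,d\mu$. The colax associator is the composite $a:\int_{\coprod_S T_s}M_{(s,t)}\,d\int_S\iota_s\gamma_s d\mu\to\int_S\int_{\coprod_S T_s}M_{(s,t)}\,d\iota_s\gamma_s\,d\mu\to\int_S\int_{T_s}M_{(s,t)}\,d\gamma_s\,d\mu$ of a Fubini transform $\Delta$ and the ultraproduct of the diagonal maps $\Delta_{\gamma_s,\iota_s}$. **Left ultrafunctor (Lurie).** A functor $F$ with natural maps $\sigma_\mu:F(\int_I M_i d\mu)\to\int_I F(M_i)d\mu$ such that $\epsilon_{I,i_0}\circ\sigma_{\delta_{i_0}}=F(\epsilon_{I,i_0})$ and $\Delta_{\mu,\nu_\bullet}\circ\sigma_{\int_S\nu_s d\mu}=(\int_S\sigma_{\nu_s}d\mu)\circ\sigma_\mu\circ F(\Delta_{\mu,\nu_\bullet})$. Morphisms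 are natural transformations $\alpha:F\to G$ with $(\int_I\alpha_{M_i}d\mu)\circ\sigma^F_\mu=\sigma^G_\mu\circ\alpha_{\int_I M_id\mu}$. **Canonical generalised structure on an ultracategory with invertible $a$.** $\beta(f,[g_i])=a^{-1}\circ(\int_I g_i d\mu)\circ f$; $\Xi_{f,\mu}$ is postcomposition with $\Delta_{\mu,f}$; $\kappa_A=\epsilon_{*,*}^{-1}:A\to\int_*A\,d*$. (If $g_i$ is defined only for $i\in U\in\mu$, $\int_I g_id\mu$ is formed over $U$ using the diagonal isomorphisms $\int_I\cong\int_U$.) This is a generalised ultracategory in the following sense. **Generalised ultracategory.** Data: a class of objects; for each object $A$, family of objects $(M_i)_{i\in I}$ and ultrafilter $\mu$ on $I$, a set $\mathrm{Hom}(A,\int_I M_i\,d\mu)$ (a formal symbol); maps $$\beta:\mathrm{Hom}(A,\textstyle\int_I M_i d\mu)\times\int_I\mathrm{Hom}(M_i,\int_{X_i}N_{(i,x)}d\lambda_i)\,d\mu\to\mathrm{Hom}(A,\int_{\coprod_I X_i}N_{(i,x)}\,d\int_I\iota_i\lambda_i d\mu);$$ for $f:J\to I$ and an ultrafilter $\mu$ on $J$, maps $\Xi_{f,\mu}:\mathrm{Hom}(A,\int_I M_i\,d f\mu)\to\mathrm{Hom}(A,\int_J M_{f(j)}\,d\mu)$ (written $\Xi_f$); and elements $\kappa_A\in\mathrm{Hom}(A,\int_*A\,d* )$. Axioms: 1. $\Xi_{\mathrm{id}}=\mathrm{id}$. 2. $\Xi_{f,\mu}$ is bijective if $f$ is injective.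 3. $\Xi_{f\circ g}=\Xi_g\circ\Xi_f$. 4. $h\mapsto\beta(\kappa_A,[h])$ is inverse to $\Xi_{f_I,\mu}$, where $f_I:I\cong\coprod_* I$. 5. $h\mapsto\beta(h,[\kappa_{M_i}])$ is inverse to $\Xi_{g_I,\mu}$, where $g_I:I\cong\coprod_I *$. 6. (a) For $f_i:K_i\to X_i$, $\lambda_i$ ultrafilters on $K_i$, and $\bar f:\coprod K_i\to\coprod X_i$ induced by the $f_i$: $\Xi_{\bar f}\beta(h,[g_i])=\beta(h,[\Xi_{f_i,\lambda_i}g_i])$. (b) For $f:J\to I$, $\mu$ on $J$, and $\tilde f:\coprod_J X_{f(j)}\to\coprod_I X_i$, $\tilde f(j,x)=(f(j),x)$: $\Xi_{\tilde f}\beta(h,[g_i])=\beta(\Xi_f h,[g_{f(j)}])$. 7. For $f\in\mathrm{Hom}(A,\int_I M_i d\mu)$, $g_i\in\mathrm{Hom}(M_i,\int_{X_i}N_{(i,x)}d\lambda_i)$, $h_{(i,x)}\in\mathrm{Hom}(N_{(i,x)},\int_{T_{(i,x)}}L_{(i,x,t)}d\omega_{(i,x)})$: $\Xi_\theta\,\beta(f,[\beta(g_i,[h_{(i,x)}]_x)]_i)=\beta(\beta(f,[g_i]),[h_{(i,x)}]_{(i,x)})$, where $\theta$ is the canonical bijection between $\coprod_I\coprod_{X_i}T_{(i,x)}$ and $\coprod_{\coprod_I X_i}T_{(i,x)}$. **Left ultrafunctor of generalised ultracategories** $F:\mathcal C\to\mathcal C'$: a function on objects together with maps $\zeta:\mathrm{Hom}(A,\int_I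 M_i d\mu)\to\mathrm{Hom}(F(A),\int_I F(M_i)d\mu)$ such that $\zeta(\beta(h,[g_i]))=\beta(\zeta(h),[\zeta(g_i)])$, $\zeta\circ\Xi_f=\Xi_f\circ\zeta$, $\zeta(\kappa_A)=\kappa_{F(A)}$. **2-morphism** $\alpha:F\Rightarrow G$: maps $\alpha^1:\mathrm{Hom}(B,\int_I F(M_i)d\mu)\to\mathrm{Hom}(B,\int_I G(M_i)d\mu)$ ($B\in\mathcal C'$, $M_i\in\mathcal C$) and $\alpha^2:\mathrm{Hom}(G(A),\int_I M'_i d\mu)\to\mathrm{Hom}(F(A),\int_I M'_i d\mu)$ ($A\in\mathcal C$, $M'_i\in\mathcal C'$), both commuting with all $\Xi_f$, with $\alpha^2\beta(h,[g_i])=\beta(\alpha^2h,[g_i])$, $\alpha^1\beta(h,[g_i])=\beta(h,[\alpha^1g_i])$, and $\alpha^1(\zeta_F(h))=\alpha^2(\zeta_G(h))$ for all $h\in\mathrm{Hom}(A,\int_I M_id\mu)$. Composition of $\alpha:F\Rightarrow G$ and $\alpha':G\Rightarrow H$ is $(\alpha'^1\circ\alpha^1,\alpha^2\circ\alpha'^2)$. *)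

(* Defs.v *)
From mathcomp Require Import all_boot.
From mathcomp Require Import boolp classical_sets filter.
From Stdlib Require Import StrictProp.

Set Implicit Arguments.
Unset Strict Implicit.
Unset Printing Implicit Defensive.

Local Open Scope classical_set_scope.

Record category := Category {
  cob :> Type;
  hom : cob -> cob -> Type;
  idm : forall A, hom A A;
  comp : forall A B C, hom B C -> hom A B -> hom A C;
  comp_idl : forall A B (f : hom A B), comp (idm B) f = f;
  comp_idr : forall A B (f : hom A B), comp f (idm A) = f;
  comp_assoc : forall A B C D (h : hom C D) (g : hom B C) (f : hom A B),
    comp h (comp g f) = comp (comp h g) f }.

Arguments hom {c} _ _.
Arguments idm {c} _.
Arguments comp {c A B C} _ _.

Notation "g \oc f" := (comp g f) (at level 50, left associativity).

Definition is_iso (C : category) (A B : C) (f : hom A B) : Prop :=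
  exists g : hom B A, g \oc f = idm A /\ f \oc g = idm B.

Definition iso_inv (C : category) (A B : C) (f : hom A B) (H : is_iso f) :
  hom B A := projT1 (cid H).

Record functor (C D : category) := Functor {
  fob :> C -> D;
  fhom : forall A B : C, hom A B -> hom (fob A) (fob B);
  fhom_id : forall A, fhom (idm A) = idm (fob A);
  fhom_comp : forall (A B E : C) (g : hom B E) (f : hom A B),
    fhom (g \oc f) = fhom g \oc fhom f }.

Arguments fhom {C D} f {A B} _ : rename.

Definition functor_id (C : category) : functor C C :=
  @Functor C C (fun A => A) (fun A B f => f)
    (fun A => erefl) (fun A B E g f => erefl).

Lemma functor_comp_id C D E (G : functor D E) (F : functor C D) A :
  fhom G (fhom F (idm A)) = idm (G (F A)).
Proof. by rewrite !fhom_id. Qed.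

Lemma functor_comp_comp C D E (G : functor D E) (F : functor C D)
    A B K (g : hom B K) (f : hom A B) :
  fhom G (fhom F (g \oc f)) = fhom G (fhom F g) \oc fhom G (fhom F f).
Proof. by rewrite !fhom_comp. Qed.

Definition functor_comp C D E (G : functor D E) (F : functor C D) :
  functor C E :=
  @Functor C E (fun A => G (F A)) (fun A B f => fhom G (fhom F f))
    (functor_comp_id G F) (functor_comp_comp G F).

Definition isomorphic_categories (C D : category) : Prop :=
  exists (F : functor C D) (G : functor D C),
    functor_comp G F = functor_id C /\ functor_comp F G = functor_id D.

(* The proof that a set system is an ultrafilter lives in [SProp], so that two
   ultrafilters with convertible underlying set systems are convertible.  All
   the identifications of ultrafilters left implicit on paper, such as
   [f (g mu) = (f \o g) mu] or the two ways of iterating integrals, then hold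
   by conversion, and no transport is needed to state the axioms below. *)
Set Primitive Projections.
Record ultrafilter (I : Type) : Type := Ultrafilter {
  uf_sets :> set I -> Prop;
  uf_ultra : Squash (UltraFilter uf_sets) }.
Unset Primitive Projections.

Definition Squash_false (P : Prop) (s : Squash P) (nP : ~ P) : False :=
  sEmpty_ind (fun _ => False)
    (match s return sEmpty with
     | squash p => match nP p return sEmpty with end
     end).

Lemma uf_ultraP I (mu : ultrafilter I) : UltraFilter (uf_sets mu).
Proof.
case: (EM (UltraFilter (uf_sets mu))) => // nU.
by case: (Squash_false (uf_ultra mu) nU).
Qed.

Section UltrafilterTheory.
Variables (I : Type) (mu : ultrafilter I).

Lemma ufT : mu setT.
Proof. by have UF := uf_ultraP mu; exact: filterT. Qed.

Lemma ufI A B : mu A -> mu B -> mu (A `&` B).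
Proof. by have UF := uf_ultraP mu; exact: filterI. Qed.

Lemma ufS A B : A `<=` B -> mu A -> mu B.
Proof. by have UF := uf_ultraP mu; exact: filterS. Qed.

Lemma uf0 : ~ mu set0.
Proof. by have UF := uf_ultraP mu; exact: filter_not_empty. Qed.

Lemma ufVC A : mu A \/ mu (~` A).
Proof. by have UF := uf_ultraP mu; exact: in_ultra_setVsetC. Qed.

End UltrafilterTheory.

Lemma ultra_intro I (F : set_system I) :
  F setT -> (forall A B, F A -> F B -> F (A `&` B)) ->
  (forall A B, A `<=` B -> F A -> F B) -> ~ F set0 ->
  (forall A, F A \/ F (~` A)) -> UltraFilter F.
Proof.
move=> FT FI FS F0 FC; split.
  by apply: Build_ProperFilter => //; split.
move=> G PG FG; rewrite eqEsubset; split=> // A GA.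
have [//|FnA] := FC A; exfalso.
apply: (@filter_not_empty _ G _).
by rewrite -(setICr A); apply: filterI => //; apply: FG.
Qed.

Lemma uf_eq I (mu nu : ultrafilter I) :
  (forall A, mu A <-> nu A) -> mu = nu.
Proof.
case: mu nu => F UF [G UG] /= FG.
have E : F = G by apply: funext => A; apply: propext.
by case: _ / E UG.
Qed.

Lemma principal_ultra I (i0 : I) : UltraFilter [set A : set I | A i0].
Proof.
apply: ultra_intro => //=.
- by move=> A B AB /AB.
- by move=> A; exact: EM.
Qed.

Definition principal I (i0 : I) : ultrafilter I :=
  @Ultrafilter I [set A | A i0] (squash (principal_ultra i0)).

Lemma push_ultra I J (f : J -> I) (mu : ultrafilter J) :
  UltraFilter [set A : set I | mu (f @^-1` A)].
Proof.
apply: ultra_intro => /=.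
- exact: ufT.
- by move=> A B; exact: ufI.
- by move=> A B AB; apply: ufS => j; exact: AB.
- exact: uf0.
- by move=> A; exact: ufVC.
Qed.

Definition push I J (f : J -> I) (mu : ultrafilter J) : ultrafilter I :=
  @Ultrafilter I [set A | mu (f @^-1` A)] (squash (push_ultra f mu)).

Lemma uint_ultra S T (mu : ultrafilter S) (nu : S -> ultrafilter T) :
  UltraFilter [set U : set T | mu [set s | nu s U]].
Proof.
apply: ultra_intro => /=.
- by apply: (ufS (A := setT)); [move=> s _; exact: ufT|exact: ufT].
- move=> A B HA HB; apply: ufS (ufI HA HB) => s [] /=; exact: ufI.
- by move=> A B AB; apply: ufS => s /=; exact: ufS.
- by apply: contra_not (@uf0 _ mu); apply: ufS => s /= /uf0.
- move=> A; have [|H] := ufVC mu [set s | nu s A]; [by left|right].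
  by apply: ufS H => s /= nA; have [] := ufVC (nu s) A.
Qed.

(* [int_S nu_s dmu], as an ultrafilter *)
Definition uint S T (mu : ultrafilter S) (nu : S -> ultrafilter T) :
  ultrafilter T :=
  @Ultrafilter T [set U | mu [set s | nu s U]] (squash (uint_ultra mu nu)).

Definition star : ultrafilter unit := principal tt.

(* Primitive projections give definitional eta, which [sigT] lacks. *)
Set Primitive Projections.
Record coprod (I : Type) (X : I -> Type) : Type :=
  inj { idx : I; elt : X idx }.
Unset Primitive Projections.

Arguments inj {I X} idx elt.
Arguments idx {I X} c.
Arguments elt {I X} c.

(* [int_I iota_i lambda_i dmu] *)
Definition dsum I (X : I -> Type) (mu : ultrafilter I)
    (lam : forall i, ultrafilter (X i)) : ultrafilter (coprod X) :=
  uint mu (fun i => push (inj i) (lam i)).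

(* the ultrafilter on [U] induced by [mu] when [U \in mu] *)
Lemma trace_ultra I (mu : ultrafilter I) (U : set I) (mU : mu U) :
  UltraFilter [set V : set {i | U i} | mu (sval @` V)].
Proof.
have E (V : set {i | U i}) :
    sval @` V = U `&` [set i | forall u : U i, V (exist _ i u)].
  rewrite eqEsubset; split=> i.
    by case=> -[j u] Vj <-; split=> //= u'; rewrite (Prop_irrelevance u' u).
  by case=> u /(_ u) Vu; exists (exist _ i u).
apply: ultra_intro => /=.
- by apply: ufS mU => i u; exists (exist _ i u).
- move=> A B; rewrite !E => HA HB; apply: ufS (ufI HA HB).
  by move=> i [[u Ai] [_ Bi]]; split=> // u'; split.
- by move=> A B AB; apply: ufS; exact: image_subset.
- by rewrite image_set0; exact: uf0.
- move=> A; have [|H] := ufVC mu (sval @` A); [by left|right].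
  apply: ufS (ufI mU H) => i [u nA]; exists (exist _ i u) => // Au.
  by apply: nA; exists (exist _ i u).
Qed.

Definition trace I (mu : ultrafilter I) (U : set I) (mU : mu U) :
  ultrafilter {i | U i} :=
  @Ultrafilter _ [set V | mu (sval @` V)] (squash (trace_ultra mU)).

Lemma push_trace I (mu : ultrafilter I) (U : set I) (mU : mu U) :
  push sval (trace mU) = mu.
Proof.
apply: uf_eq => A /=; split.
  by apply: ufS => i [[j u] /= Aj <-].
by move=> mA; apply: ufS (ufI mU mA) => i [u Ai]; exists (exist _ i u).
Qed.

(* an element of the product over [i \in dom] of the sets [S i] *)
Record pfam I (mu : ultrafilter I) (S : I -> Type) : Type := Pfam {
  dom : set I;
  dom_mem : mu dom;
  pval : forall i, dom i -> S i }.

Definition germ_eq I (mu : ultrafilter I) (S : I -> Type) (p q : pfam mu S) :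
  Prop :=
  exists2 W : set I, mu W &
    forall i, W i -> exists (pi : dom p i) (qi : dom q i),
      pval pi = pval qi.

(* the colimit over [U \in mu] of the products, as equivalence classes *)
Record ultraproduct I (mu : ultrafilter I) (S : I -> Type) : Type :=
  Ultraproduct {
    germ_class : set (pfam mu S);
    germ_classP : exists p, germ_class = germ_eq p }.

Definition germ I (mu : ultrafilter I) (S : I -> Type) (p : pfam mu S) :
  ultraproduct mu S :=
  @Ultraproduct I mu S (germ_eq p) (ex_intro _ p erefl).

Definition total I (mu : ultrafilter I) (S : I -> Type)
  (s : forall i, S i) : pfam mu S :=
  @Pfam I mu S setT (ufT mu) (fun i _ => s i).

Definition pfam_map I (mu : ultrafilter I) (S S' : I -> Type)
  (f : forall i, S i -> S' i) (p : pfam mu S) : pfam mu S' :=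
  @Pfam I mu S' (dom p) (dom_mem p) (fun i u => f i (pval u)).

Lemma pfam_map_id I (mu : ultrafilter I) (S : I -> Type) (p : pfam mu S) :
  pfam_map (fun i s => s) p = p.
Proof. by case: p. Qed.

Definition pfam_pull I J (f : J -> I) (mu : ultrafilter J) (S : I -> Type)
  (p : pfam (push f mu) S) : pfam mu (fun j => S (f j)) :=
  @Pfam J mu (fun j => S (f j)) (f @^-1` dom p) (dom_mem p)
    (fun j (u : dom p (f j)) => pval u).

Section Fiber.
Variables (I : Type) (X : I -> Type) (mu : ultrafilter I).
Variables (lam : forall i, ultrafilter (X i)) (S : coprod X -> Type).
Variable h : pfam (dsum mu lam) S.

(* the indices [i] for which the germ of [x |-> h_(i,x)] is defined *)
Definition fiber_dom : set I := [set i | lam i (inj i @^-1` dom h)].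

Lemma fiber_dom_mem : mu fiber_dom.
Proof. exact: (dom_mem h). Qed.

Definition fiber i (u : fiber_dom i) :
  pfam (lam i) (fun x => S (inj i x)) :=
  @Pfam (X i) (lam i) (fun x => S (inj i x)) (inj i @^-1` dom h) u
    (fun x (v : dom h (inj i x)) => pval v).

End Fiber.

Lemma germ_eq_refl I (mu : ultrafilter I) (S : I -> Type) (p : pfam mu S) :
  germ_eq p p.
Proof. by exists (dom p) => [|i u]; [exact: dom_mem|exists u, u]. Qed.

Lemma germ_eq_sym I (mu : ultrafilter I) (S : I -> Type) (p q : pfam mu S) :
  germ_eq p q -> germ_eq q p.
Proof. by case=> W mW H; exists W => // i /H [u [v E]]; exists v, u. Qed.

Lemma germ_eq_trans I (mu : ultrafilter I) (S : I -> Type)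
  (p q r : pfam mu S) : germ_eq p q -> germ_eq q r -> germ_eq p r.
Proof.
case=> V mV HV [W mW HW]; exists (V `&` W); first exact: ufI.
move=> i [/HV [u [v E]] /HW [v' [w E']]]; exists u, w.
by rewrite E (Prop_irrelevance v v').
Qed.

Lemma germP I (mu : ultrafilter I) (S : I -> Type) (p q : pfam mu S) :
  germ p = germ q <-> germ_eq p q.
Proof.
split=> [E|pq].
  have {E} : germ_class (germ p) = germ_class (germ q) by rewrite E.
  by move=> /= ->; exact: germ_eq_refl.
rewrite /germ; move: (ex_intro _ q _) => Hq.
move: (ex_intro _ p _) => Hp.
have E : germ_eq p = germ_eq q.
  apply: funext => r; apply: propext; split.
    by apply: germ_eq_trans; exact: germ_eq_sym.
  exact: germ_eq_trans.
by case: _ / E Hq => Hq; rewrite (Prop_irrelevance Hp Hq).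
Qed.

Record ultracategory := Ultracategory {
  ucat :> category;
  uprod : forall I : Type, ultrafilter I -> (I -> ucat) -> ucat;
  umap : forall (I : Type) (mu : ultrafilter I) (M N : I -> ucat),
    (forall i, hom (M i) (N i)) -> hom (uprod mu M) (uprod mu N);
  umap_id : forall I (mu : ultrafilter I) (M : I -> ucat),
    umap mu (fun i => idm (M i)) = idm (uprod mu M);
  umap_comp : forall I (mu : ultrafilter I) (M N P : I -> ucat)
    (g : forall i, hom (N i) (P i)) (f : forall i, hom (M i) (N i)),
    umap mu (fun i => g i \oc f i) = umap mu g \oc umap mu f;
  eps : forall (I : Type) (i0 : I) (M : I -> ucat),
    hom (uprod (principal i0) M) (M i0);
  eps_nat : forall I (i0 : I) (M N : I -> ucat)
    (f : forall i, hom (M i) (N i)),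
    eps i0 N \oc umap (principal i0) f = f i0 \oc eps i0 M;
  eps_iso : forall I (i0 : I) (M : I -> ucat), is_iso (eps i0 M);
  Delta : forall (S T : Type) (mu : ultrafilter S) (nu : S -> ultrafilter T)
    (M : T -> ucat),
    hom (uprod (uint mu nu) M) (uprod mu (fun s => uprod (nu s) M));
  Delta_nat : forall S T (mu : ultrafilter S) (nu : S -> ultrafilter T)
    (M N : T -> ucat) (f : forall t, hom (M t) (N t)),
    Delta mu nu N \oc umap (uint mu nu) f =
    umap mu (fun s => umap (nu s) f) \oc Delta mu nu M;
  Delta_eps : forall S T (s0 : S) (nu : S -> ultrafilter T) (M : T -> ucat),
    eps s0 (fun s => uprod (nu s) M) \oc Delta (principal s0) nu M =
    idm (uprod (nu s0) M) /\
    (Delta (principal s0) nu M : hom (uprod (nu s0) M) _) \oc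
    eps s0 (fun s => uprod (nu s) M) = idm _;
  Delta_injective : forall S T (f : S -> T) (mu : ultrafilter S)
    (M : T -> ucat),
    injective f -> is_iso (Delta mu (fun s => principal (f s)) M);
  Delta_assoc : forall R S T (lam : ultrafilter R) (mu : R -> ultrafilter S)
    (nu : S -> ultrafilter T) (M : T -> ucat),
    umap lam (fun r => Delta (mu r) nu M) \oc
      Delta lam (fun r => uint (mu r) nu) M =
    Delta lam mu (fun s => uprod (nu s) M) \oc Delta (uint lam mu) nu M }.

Arguments uprod {u I} mu M.
Arguments umap {u I} mu {M N} _.
Arguments eps {u I} i0 M.
Arguments Delta {u S T} mu nu M.

(* the ultraproduct diagonal map written [Delta_{mu,f}] *)
Definition diag (B : ultracategory) S T (mu : ultrafilter S) (f : S -> T)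
    (M : T -> B) :
  hom (uprod (push f mu) M) (uprod mu (fun s => M (f s))) :=
  umap mu (fun s => eps (f s) M) \oc Delta mu (fun s => principal (f s)) M.

Definition colax_assoc (B : ultracategory) S (T : S -> Type)
    (mu : ultrafilter S) (gam : forall s, ultrafilter (T s))
    (M : coprod T -> B) :
  hom (uprod (dsum mu gam) M)
      (uprod mu (fun s => uprod (gam s) (fun t => M (inj s t)))) :=
  umap mu (fun s => diag (gam s) (inj s) M) \oc
  Delta mu (fun s => push (inj s) (gam s)) M.

Definition assoc_invertible (B : ultracategory) : Prop :=
  forall (S : Type) (T : S -> Type) (mu : ultrafilter S)
    (gam : forall s, ultrafilter (T s)) (M : coprod T -> B),
    is_iso (colax_assoc mu gam M).

Record left_ultrafunctor (B B' : ultracategory) := LeftUltrafunctor {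
  lfun :> functor B B';
  sigma : forall (I : Type) (mu : ultrafilter I) (M : I -> B),
    hom (lfun (uprod mu M)) (uprod mu (fun i => lfun (M i)));
  sigma_nat : forall I (mu : ultrafilter I) (M N : I -> B)
    (f : forall i, hom (M i) (N i)),
    sigma mu N \oc fhom lfun (umap mu f) =
    umap mu (fun i => fhom lfun (f i)) \oc sigma mu M;
  sigma_eps : forall I (i0 : I) (M : I -> B),
    eps i0 (fun i => lfun (M i)) \oc sigma (principal i0) M =
    fhom lfun (eps i0 M);
  sigma_Delta : forall S T (mu : ultrafilter S) (nu : S -> ultrafilter T)
    (M : T -> B),
    Delta mu nu (fun t => lfun (M t)) \oc sigma (uint mu nu) M =
    umap mu (fun s => sigma (nu s) M) \oc
      sigma mu (fun s => uprod (nu s) M) \oc fhom lfun (Delta mu nu M) }.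

Arguments sigma {B B'} l {I} mu M.

Record left_ultra_nat (B B' : ultracategory) (F G : left_ultrafunctor B B') :=
  LeftUltraNat {
    ncomp :> forall A : B, hom (F A) (G A);
    ncomp_nat : forall (A C : B) (f : hom A C),
      ncomp C \oc fhom F f = fhom G f \oc ncomp A;
    ncomp_sigma : forall I (mu : ultrafilter I) (M : I -> B),
      umap mu (fun i => ncomp (M i)) \oc sigma F mu M =
      sigma G mu M \oc ncomp (uprod mu M) }.

Section LeftUltrafunctorCategory.
Variables B B' : ultracategory.
Implicit Types F G H : left_ultrafunctor B B'.

Lemma left_ultra_nat_eq F G (a b : left_ultra_nat F G) :
  (forall A, a A = b A) -> a = b.
Proof.
case: a b => a a1 a2 [b b1 b2] /= ab.
have E : a = b by exact: functional_extensionality_dep.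
case: _ / E b1 b2 => b1 b2.
by rewrite (Prop_irrelevance a1 b1) (Prop_irrelevance a2 b2).
Qed.

Program Definition left_ultra_id F : left_ultra_nat F F :=
  @LeftUltraNat B B' F F (fun A => idm (F A)) _ _.
Next Obligation. by move=> F A C f /=; rewrite comp_idl comp_idr. Qed.
Next Obligation.
by move=> F I mu M /=; rewrite umap_id comp_idl comp_idr.
Qed.

Program Definition left_ultra_comp F G H (b : left_ultra_nat G H)
    (a : left_ultra_nat F G) : left_ultra_nat F H :=
  @LeftUltraNat B B' F H (fun A => b A \oc a A) _ _.
Next Obligation.
move=> F G H b a A C f /=.
by rewrite -comp_assoc ncomp_nat comp_assoc ncomp_nat comp_assoc.
Qed.
Next Obligation.
move=> F G H b a I mu M /=.
by rewrite umap_comp -comp_assoc ncomp_sigma comp_assoc ncomp_sigma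
  comp_assoc.
Qed.

Program Definition left_ultrafunctor_category : category :=
  @Category (left_ultrafunctor B B') (@left_ultra_nat B B')
    left_ultra_id left_ultra_comp _ _ _.
Next Obligation.
by move=> F G f; apply: left_ultra_nat_eq => A /=; rewrite comp_idl.
Qed.
Next Obligation.
by move=> F G f; apply: left_ultra_nat_eq => A /=; rewrite comp_idr.
Qed.
Next Obligation.
by move=> F G H K h g f; apply: left_ultra_nat_eq => A /=; rewrite comp_assoc.
Qed.

End LeftUltrafunctorCategory.

Record gen_data := GenData {
  gob :> Type;
  (* [ghom A M mu] is the set written [Hom(A, int_I M_i dmu)] *)
  ghom : gob -> forall I : Type, (I -> gob) -> ultrafilter I -> Type;
  gbeta : forall (A : gob) (I : Type) (M : I -> gob) (mu : ultrafilter I)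
    (X : I -> Type) (N : coprod X -> gob) (lam : forall i, ultrafilter (X i)),
    ghom A M mu ->
    ultraproduct mu (fun i => ghom (M i) (fun x => N (inj i x)) (lam i)) ->
    ghom A N (dsum mu lam);
  gXi : forall (A : gob) (I J : Type) (f : J -> I) (M : I -> gob)
    (mu : ultrafilter J),
    ghom A M (push f mu) -> ghom A (fun j => M (f j)) mu;
  gkappa : forall A : gob, ghom A (fun _ : unit => A) star }.

Arguments ghom {g} A {I} M mu.
Arguments gbeta {g A I M mu X} N {lam} _ _.
Arguments gXi {g A I J} f {M mu} _.
Arguments gkappa {g} A.

(* Every element of an [ultraproduct] is [germ g] for some partial family [g],
   so the laws are stated on representatives.  In [gbeta_assoc], the family
   [i |-> beta(g_i, [h_(i,x)]_x)] is defined where [g_i] is and where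
   [x |-> h_(i,x)] is defined almost everywhere. *)
Record gen_ultracategory := GenUltracategory {
  gdata :> gen_data;
  gXi_id : forall (A : gdata) I (M : I -> gdata) (mu : ultrafilter I)
    (h : ghom A M mu),
    gXi (fun i => i) h = h;
  gXi_bij : forall (A : gdata) I J (f : J -> I) (M : I -> gdata)
    (mu : ultrafilter J),
    injective f -> bijective (@gXi gdata A I J f M mu);
  gXi_comp : forall (A : gdata) I J K (f : J -> I) (g : K -> J)
    (M : I -> gdata) (mu : ultrafilter K) (h : ghom A M (push f (push g mu))),
    gXi (fun k => f (g k)) (h : ghom A M (push (fun k => f (g k)) mu)) =
    gXi g (gXi f h);
  gbeta_kappal : forall (A : gdata) I (M : I -> gdata) (mu : ultrafilter I),
    let N (p : coprod (fun _ : unit => I)) := M (elt p) in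
    let b (h : ghom A M mu) : ghom A N (dsum star (fun _ => mu)) :=
      gbeta N (gkappa A) (germ (total star (fun _ => h))) in
    let Xi : ghom A N (push (inj tt) mu) -> ghom A M mu :=
      gXi (inj tt) in
    cancel b Xi /\ cancel Xi b;
  gbeta_kappar : forall (A : gdata) I (M : I -> gdata) (mu : ultrafilter I),
    let N (p : coprod (fun _ : I => unit)) := M (idx p) in
    let b (h : ghom A M mu) : ghom A N (dsum mu (fun _ => star)) :=
      gbeta N h (germ (total mu (fun i => gkappa (M i)))) in
    let Xi : ghom A N (push (fun i => inj i tt) mu) -> ghom A M mu :=
      gXi (fun i => inj i tt) in
    cancel b Xi /\ cancel Xi b;
  gbeta_Xir : forall (A : gdata) I (M : I -> gdata) (mu : ultrafilter I)
    (X K : I -> Type) (f : forall i, K i -> X i) (N : coprod X -> gdata)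
    (lam : forall i, ultrafilter (K i)) (h : ghom A M mu)
    (g : pfam mu (fun i =>
      ghom (M i) (fun x => N (inj i x)) (push (f i) (lam i)))),
    let fbar (p : coprod K) : coprod X := inj (idx p) (f (idx p) (elt p)) in
    @gXi gdata A (coprod X) (coprod K) fbar N (dsum mu lam)
      (gbeta N (lam := fun i => push (f i) (lam i)) h (germ g)) =
    gbeta (fun p => N (fbar p)) h
      (germ (pfam_map (fun i =>
        @gXi gdata (M i) (X i) (K i) (f i) (fun x => N (inj i x)) (lam i)) g));
  gbeta_Xil : forall (A : gdata) I J (f : J -> I) (M : I -> gdata)
    (mu : ultrafilter J) (X : I -> Type) (N : coprod X -> gdata)
    (lam : forall i, ultrafilter (X i)) (h : ghom A M (push f mu))
    (g : pfam (push f mu) (fun i =>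
      ghom (M i) (fun x => N (inj i x)) (lam i))),
    let ftilde (p : coprod (fun j => X (f j))) : coprod X :=
      inj (f (idx p)) (elt p) in
    @gXi gdata A (coprod X) (coprod (fun j => X (f j))) ftilde N
      (dsum mu (fun j => lam (f j))) (gbeta N h (germ g)) =
    gbeta (fun p => N (ftilde p)) (gXi f h) (germ (pfam_pull g));
  gbeta_assoc : forall (A : gdata) I (M : I -> gdata) (mu : ultrafilter I)
    (X : I -> Type) (N : coprod X -> gdata) (lam : forall i, ultrafilter (X i))
    (T : coprod X -> Type)
    (L : coprod (fun i => coprod (fun x : X i => T (inj i x))) -> gdata)
    (om : forall p, ultrafilter (T p))
    (f : ghom A M mu)
    (g : pfam mu (fun i => ghom (M i) (fun x => N (inj i x)) (lam i)))
    (h : pfam (dsum mu lam) (fun p =>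
      ghom (N p) (fun t => L (inj (idx p) (inj (elt p) t))) (om p))),
    let theta (q : coprod T) :
        coprod (fun i => coprod (fun x : X i => T (inj i x))) :=
      inj (idx (idx q)) (inj (elt (idx q)) (elt q)) in
    let gh : pfam mu (fun i => ghom (M i) (fun p => L (inj i p))
        (dsum (lam i) (fun x => om (inj i x)))) :=
      @Pfam I mu _ (dom g `&` fiber_dom h)
        (ufI (dom_mem g) (fiber_dom_mem h))
        (fun i u => gbeta (fun p => L (inj i p)) (pval (proj1 u))
          (germ (fiber (proj2 u)))) in
    @gXi gdata A _ (coprod T) theta L (dsum (dsum mu lam) om)
      (gbeta L f (germ gh)) =
    gbeta (fun q => L (theta q)) (gbeta N f (germ g)) (germ h) }.


Record gen_left_ultrafunctor (C C' : gen_ultracategory) :=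
  GenLeftUltrafunctor {
    gfob :> C -> C';
    zeta : forall (A : C) I (M : I -> C) (mu : ultrafilter I),
      ghom A M mu -> ghom (gfob A) (fun i => gfob (M i)) mu;
    zeta_beta : forall (A : C) I (M : I -> C) (mu : ultrafilter I)
      (X : I -> Type) (N : coprod X -> C) (lam : forall i, ultrafilter (X i))
      (h : ghom A M mu)
      (g : pfam mu (fun i => ghom (M i) (fun x => N (inj i x)) (lam i))),
      zeta (gbeta N h (germ g)) =
      gbeta (fun p => gfob (N p)) (zeta h)
        (germ (pfam_map (fun i => @zeta (M i) (X i) _ (lam i)) g));
    zeta_Xi : forall (A : C) I J (f : J -> I) (M : I -> C)
      (mu : ultrafilter J) (h : ghom A M (push f mu)),
      zeta (gXi f h) = gXi f (zeta h);
    zeta_kappa : forall A : C, zeta (gkappa A) = gkappa (gfob A) }.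

Arguments zeta {C C'} g {A I M mu} _ : rename.

Record gen_left_ultra_nat (C C' : gen_ultracategory)
    (F G : gen_left_ultrafunctor C C') := GenLeftUltraNat {
  alpha1 : forall (B : C') I (M : I -> C) (mu : ultrafilter I),
    ghom B (fun i => F (M i)) mu -> ghom B (fun i => G (M i)) mu;
  alpha2 : forall (A : C) I (M' : I -> C') (mu : ultrafilter I),
    ghom (G A) M' mu -> ghom (F A) M' mu;
  alpha1_Xi : forall (B : C') I J (f : J -> I) (M : I -> C)
    (mu : ultrafilter J) (h : ghom B (fun i => F (M i)) (push f mu)),
    alpha1 (M := fun j => M (f j)) (gXi f h) = gXi f (alpha1 h);
  alpha2_Xi : forall (A : C) I J (f : J -> I) (M' : I -> C')
    (mu : ultrafilter J) (h : ghom (G A) M' (push f mu)),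
    alpha2 (gXi f h) = gXi f (alpha2 h);
  alpha2_beta : forall (A : C) I (M' : I -> C') (mu : ultrafilter I)
    (X : I -> Type) (N : coprod X -> C') (lam : forall i, ultrafilter (X i))
    (h : ghom (G A) M' mu)
    (g : pfam mu (fun i => ghom (M' i) (fun x => N (inj i x)) (lam i))),
    alpha2 (gbeta N h (germ g)) = gbeta N (alpha2 h) (germ g);
  alpha1_beta : forall (B : C') I (M' : I -> C') (mu : ultrafilter I)
    (X : I -> Type) (N : coprod X -> C) (lam : forall i, ultrafilter (X i))
    (h : ghom B M' mu)
    (g : pfam mu (fun i => ghom (M' i) (fun x => F (N (inj i x))) (lam i))),
    alpha1 (gbeta (fun p => F (N p)) h (germ g)) =
    gbeta (fun p => G (N p)) h
      (germ (pfam_map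
        (fun i => @alpha1 (M' i) (X i) (fun x => N (inj i x)) (lam i)) g));
  alpha_zeta : forall (A : C) I (M : I -> C) (mu : ultrafilter I)
    (h : ghom A M mu), alpha1 (zeta F h) = alpha2 (zeta G h) }.

Arguments alpha1 {C C' F G} g {B I M mu} _ : rename.
Arguments alpha2 {C C' F G} g {A I M' mu} _ : rename.

Section GenLeftUltrafunctorCategory.
Variables C C' : gen_ultracategory.
Implicit Types F G H : gen_left_ultrafunctor C C'.

Lemma gen_left_ultra_nat_eq F G (a b : gen_left_ultra_nat F G) :
  @alpha1 _ _ _ _ a = @alpha1 _ _ _ _ b ->
  @alpha2 _ _ _ _ a = @alpha2 _ _ _ _ b -> a = b.
Proof.
case: a b => a1 a2 p1 p2 p3 p4 p5 [b1 b2 q1 q2 q3 q4 q5] /= E1 E2.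
case: _ / E1 q1 q4 q5 => q1 q4; case: _ / E2 q2 q3 => q2 q3 q5.
by rewrite (Prop_irrelevance p1 q1) (Prop_irrelevance p2 q2)
  (Prop_irrelevance p3 q3) (Prop_irrelevance p4 q4) (Prop_irrelevance p5 q5).
Qed.

Program Definition gen_left_ultra_id F : gen_left_ultra_nat F F :=
  @GenLeftUltraNat C C' F F (fun _ _ _ _ h => h) (fun _ _ _ _ h => h)
    _ _ _ _ _.
Next Obligation. by []. Qed.
Next Obligation. by []. Qed.
Next Obligation. by []. Qed.
Next Obligation. by move=> *; rewrite pfam_map_id. Qed.
Next Obligation. by []. Qed.

(* well-definedness of composition relies on the left unit axiom of [C'] *)
Lemma alpha1_alpha2 F G H (b : gen_left_ultra_nat G H)
    (a : gen_left_ultra_nat F G) (A : C) I (M : I -> C) (mu : ultrafilter I)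
    (k : ghom (G A) (fun i => G (M i)) mu) :
  alpha1 b (alpha2 a k) = alpha2 a (alpha1 b k).
Proof.
pose N (p : coprod (fun _ : unit => I)) := M (elt p).
have [/(_ k) Kk _] := gbeta_kappal (G A) (fun i => G (M i)) mu.
have [/(_ (alpha1 b k)) Kb _] := gbeta_kappal (G A) (fun i => H (M i)) mu.
rewrite -Kb -[in LHS]Kk.
rewrite [RHS](alpha2_Xi a (f := inj tt) (M' := fun p => H (N p))).
rewrite [alpha2 a _](alpha2_Xi a (f := inj tt) (M' := fun p => G (N p))).
have E2 (P : coprod (fun _ : unit => I) -> C') :=
  alpha2_beta a (M' := fun _ => G A) (N := P) (lam := fun _ => mu)
    (gkappa (G A)).
rewrite (E2 (fun p => G (N p))) (E2 (fun p => H (N p))).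
rewrite [LHS](alpha1_Xi b (f := inj tt) (M := N)).
apply: (congr1 (@gXi C' _ _ _ (inj tt) (fun p => H (N p)) mu)).
exact: (alpha1_beta b (M' := fun _ => G A) (N := N) (lam := fun _ => mu)
  (alpha2 a (gkappa (G A))) (total star (fun _ => k))).
Qed.

Program Definition gen_left_ultra_comp F G H (b : gen_left_ultra_nat G H)
    (a : gen_left_ultra_nat F G) : gen_left_ultra_nat F H :=
  @GenLeftUltraNat C C' F H
    (fun B I M mu h => alpha1 b (alpha1 a h))
    (fun A I M' mu h => alpha2 a (alpha2 b h)) _ _ _ _ _.
Next Obligation.
move=> F G H b a B I J f M mu h /=; rewrite -(alpha1_Xi b).
by congr (alpha1 b _); exact: (alpha1_Xi a).
Qed.
Next Obligation.
by move=> F G H b a A I J f M mu h /=; rewrite (alpha2_Xi b) (alpha2_Xi a).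
Qed.
Next Obligation.
move=> F G H b a A I M mu X N lam h g /=.
by rewrite (alpha2_beta b) (alpha2_beta a).
Qed.
Next Obligation.
move=> F G H b a B I M mu X N lam h g /=.
by rewrite (alpha1_beta a) (alpha1_beta b).
Qed.
Next Obligation.
move=> F G H b a A I M mu h /=.
by rewrite (alpha_zeta a) alpha1_alpha2 (alpha_zeta b).
Qed.

Program Definition gen_left_ultrafunctor_category : category :=
  @Category (gen_left_ultrafunctor C C') (@gen_left_ultra_nat C C')
    gen_left_ultra_id gen_left_ultra_comp _ _ _.
Next Obligation. by move=> *; apply: gen_left_ultra_nat_eq. Qed.
Next Obligation. by move=> *; apply: gen_left_ultra_nat_eq. Qed.
Next Obligation. by move=> *; apply: gen_left_ultra_nat_eq. Qed.

End GenLeftUltrafunctorCategory.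

Section CategoryTheory.
Variable C : category.

Lemma iso_invK (A A' : C) (f : hom A A') (H : is_iso f) :
  iso_inv H \oc f = idm A.
Proof. by rewrite /iso_inv; case: (cid H) => g []. Qed.

Lemma iso_invVK (A A' : C) (f : hom A A') (H : is_iso f) :
  f \oc iso_inv H = idm A'.
Proof. by rewrite /iso_inv; case: (cid H) => g []. Qed.

Lemma iso_monoL (A A' D : C) (f : hom A A') (g h : hom D A) :
  is_iso f -> f \oc g = f \oc h -> g = h.
Proof.
by move=> [k [kf _]] E; rewrite -[g]comp_idl -[h]comp_idl -kf -!comp_assoc E.
Qed.

Lemma iso_comp (A A' D : C) (g : hom A' D) (f : hom A A') :
  is_iso g -> is_iso f -> is_iso (g \oc f).
Proof.
move=> [g' [g1 g2]] [f' [f1 f2]]; exists (f' \oc g'); split.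
  by rewrite -comp_assoc (comp_assoc g') g1 comp_idl.
by rewrite -comp_assoc (comp_assoc f) f2 comp_idl.
Qed.

Lemma comp_isoVK (A A' D E : C) (f : hom A A') (H : is_iso f)
    (g : hom A' D) (x : hom E A') :
  g \oc f \oc (iso_inv H \oc x) = g \oc x.
Proof. by rewrite -comp_assoc (comp_assoc f) iso_invVK comp_idl. Qed.

Lemma comp_isoVKK (A A' D E : C) (f : hom A A') (H : is_iso f)
    (e : hom A' D) (k : hom D A') (x : hom E D) :
  e \oc k = idm D -> e \oc f \oc (iso_inv H \oc (k \oc x)) = x.
Proof. by move=> ek; rewrite comp_isoVK comp_assoc ek comp_idl. Qed.

Lemma comp_isoKK (A A' D E : C) (f : hom A A') (H : is_iso f)
    (e : hom A' D) (k : hom D A') (x : hom E A) :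
  k \oc e = idm A' -> iso_inv H \oc (k \oc (e \oc f \oc x)) = x.
Proof.
by move=> ke; rewrite -comp_assoc (comp_assoc k) ke comp_idl comp_assoc
  iso_invK comp_idl.
Qed.

End CategoryTheory.

Section UltracategoryTheory.
Variable B : ultracategory.

Lemma umap_iso I (mu : ultrafilter I) (M N : I -> B)
    (g : forall i, hom (M i) (N i)) :
  (forall i, is_iso (g i)) -> is_iso (umap mu g).
Proof.
move=> Hg; exists (umap mu (fun i => iso_inv (Hg i))).
rewrite -!umap_comp -!umap_id; split; congr (umap mu _);
  by apply: functional_extensionality_dep => i; rewrite ?iso_invK ?iso_invVK.
Qed.

Lemma eq_umap I (mu : ultrafilter I) (M N : I -> B)
    (g h : forall i, hom (M i) (N i)) :
  (forall i, g i = h i) -> umap mu g = umap mu h.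
Proof. by move=> gh; congr umap; apply: functional_extensionality_dep. Qed.

Lemma diag_nat S T (mu : ultrafilter S) (f : S -> T) (M N : T -> B)
    (g : forall t, hom (M t) (N t)) :
  diag mu f N \oc umap (push f mu) g =
  umap mu (fun s => g (f s)) \oc diag mu f M.
Proof.
rewrite /diag -comp_assoc.
rewrite (Delta_nat mu (fun s => principal (f s)) g).
rewrite !comp_assoc -!umap_comp; congr (_ \oc _).
by apply: eq_umap => s; exact: eps_nat.
Qed.

Lemma diag_Delta R S T (mu : ultrafilter R) (f : R -> S)
    (nu : S -> ultrafilter T) (M : T -> B) :
  diag mu f (fun s => uprod (nu s) M) \oc Delta (push f mu) nu M =
  Delta mu (fun r => nu (f r)) M.
Proof.
rewrite /diag -comp_assoc.
have E := Delta_assoc mu (fun r => principal (f r)) nu M.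
rewrite -[X in _ \oc X]E comp_assoc -umap_comp.
rewrite (@eq_umap _ _ _ _ _ (fun r => idm (uprod (nu (f r)) M))).
  by rewrite umap_id comp_idl.
by move=> r; case: (Delta_eps (f r) nu M).
Qed.

Lemma Delta_diag S T U (mu : ultrafilter S) (nu : S -> ultrafilter T)
    (f : T -> U) (M : U -> B) :
  Delta mu nu (fun t => M (f t)) \oc diag (uint mu nu) f M =
  umap mu (fun s => diag (nu s) f M) \oc
    Delta mu (fun s => push f (nu s)) M.
Proof.
rewrite /diag comp_assoc (Delta_nat mu nu (fun t => eps (f t) M)).
rewrite umap_comp -!comp_assoc; congr (_ \oc _).
by rewrite -[LHS](Delta_assoc mu nu (fun t => principal (f t)) M).
Qed.

Lemma eps_Delta S T (s0 : S) (nu : S -> ultrafilter T) (M : T -> B) :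
  eps s0 (fun s => uprod (nu s) M) \oc Delta (principal s0) nu M =
  idm (uprod (nu s0) M).
Proof. by case: (Delta_eps s0 nu M). Qed.

Lemma diag_comp R S T (mu : ultrafilter R) (f : S -> T) (g : R -> S)
    (M : T -> B) :
  diag mu g (fun s => M (f s)) \oc diag (push g mu) f M =
  diag mu (fun r => f (g r)) M.
Proof.
rewrite {2}/diag comp_assoc.
rewrite (diag_nat mu g (fun s => eps (f s) M)) -comp_assoc.
by rewrite (diag_Delta mu g (fun s => principal (f s)) M).
Qed.

Lemma diag_iso S T (mu : ultrafilter S) (f : S -> T) (M : T -> B) :
  injective f -> is_iso (diag mu f M).
Proof.
move=> f_inj; apply: iso_comp; last exact: Delta_injective.
by apply: umap_iso => s; exact: eps_iso.
Qed.

Lemma diag_id S (mu : ultrafilter S) (M : S -> B) :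
  diag mu (fun s => s) M = idm (uprod mu M).
Proof.
have I1 : is_iso (diag mu (fun s => s) M) by apply: diag_iso.
apply: (iso_monoL I1); rewrite comp_idr.
exact: (diag_comp mu (fun s => s) (fun s => s) M).
Qed.

Lemma eps_diag S T (s0 : S) (f : S -> T) (M : T -> B) :
  eps s0 (fun s => M (f s)) \oc diag (principal s0) f M = eps (f s0) M.
Proof.
rewrite /diag comp_assoc (eps_nat s0 (fun s => eps (f s) M)) -comp_assoc.
by rewrite (eps_Delta s0 (fun s => principal (f s)) M) comp_idr.
Qed.

(* [diag] along a map [f] with [f nu = mu] *)
Definition diag_to I J (mu : ultrafilter I) (nu : ultrafilter J) (f : J -> I)
    (e : push f nu = mu) (M : I -> B) :
  hom (uprod mu M) (uprod nu (fun j => M (f j))) :=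
  match e in _ = mu' return hom (uprod mu' M) _ with
  | erefl => diag nu f M
  end.

Lemma diag_to_nat I J (mu : ultrafilter I) (nu : ultrafilter J) (f : J -> I)
    (e : push f nu = mu) (M N : I -> B) (g : forall i, hom (M i) (N i)) :
  diag_to e N \oc umap mu g = umap nu (fun j => g (f j)) \oc diag_to e M.
Proof. by case: _ / e => /=; exact: diag_nat. Qed.

Lemma diag_to_iso I J (mu : ultrafilter I) (nu : ultrafilter J) (f : J -> I)
    (e : push f nu = mu) (M : I -> B) :
  injective f -> is_iso (diag_to e M).
Proof. by case: _ / e => /=; exact: diag_iso. Qed.

Lemma diag_to_comp I J K (mu : ultrafilter I) (nu : ultrafilter J)
    (ka : ultrafilter K) (f : J -> I) (g : K -> J)
    (e1 : push f nu = mu) (e2 : push g ka = nu)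
    (e3 : push (fun k => f (g k)) ka = mu) (M : I -> B) :
  diag_to e2 (fun j => M (f j)) \oc diag_to e1 M = diag_to e3 M.
Proof.
case: _ / e2 e1 => e1; case: _ / e1 e3 => e3.
by rewrite (Prop_irrelevance e3 erefl) /=; exact: diag_comp.
Qed.

Lemma sval_injective I (U : set I) : injective (@sval I U).
Proof.
by move=> [i u] [j v] /= E; case: _ / E v => v; rewrite (Prop_irrelevance u v).
Qed.

(* [int_I g_i dmu] for [g_i] defined on [U \in mu] only, through the
   isomorphisms [int_I M_i dmu = int_U M_i dmu] *)
Definition pumap I (mu : ultrafilter I) (M N : I -> B)
    (p : pfam mu (fun i => hom (M i) (N i))) :
  hom (uprod mu M) (uprod mu N) :=
  iso_inv (diag_to_iso (push_trace (dom_mem p)) N (@sval_injective _ _)) \oc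
  (umap (trace (dom_mem p)) (fun u => pval (proj2_sig u)) \oc
   diag_to (push_trace (dom_mem p)) M).

Definition umap_germ I (mu : ultrafilter I) (M N : I -> B)
    (c : ultraproduct mu (fun i => hom (M i) (N i))) :
  hom (uprod mu M) (uprod mu N) := pumap (projT1 (cid (germ_classP c))).

Section Pumap.
Variables (I : Type) (mu : ultrafilter I) (M N : I -> B).
Implicit Types p q : pfam mu (fun i => hom (M i) (N i)).

Lemma pumapE p J (nu : ultrafilter J) (j : J -> I) (e : push j nu = mu)
    (d : forall x, dom p (j x)) :
  diag_to e N \oc pumap p = umap nu (fun x => pval (d x)) \oc diag_to e M.
Proof.
pose k x : {i | dom p i} := exist _ (j x) (d x).
have ek : push k nu = trace (dom_mem p).
  apply: uf_eq => V.
  have /= E := congr1 (fun m => uf_sets m (sval @` V)) e.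
  rewrite /= -E; split; apply: ufS => x /=.
    by move=> Vk; exists (k x).
  case=> u Vu uE; suff -> : k x = u by [].
  exact: sval_injective.
rewrite -!(diag_to_comp (push_trace (dom_mem p)) ek).
rewrite /pumap -comp_assoc [X in _ \oc X]comp_assoc iso_invVK comp_idl.
rewrite !comp_assoc.
by rewrite (diag_to_nat ek (fun u => pval (proj2_sig u))).
Qed.

Lemma pumap_uniq p J (nu : ultrafilter J) (j : J -> I) (e : push j nu = mu)
    (d : forall x, dom p (j x)) m :
  injective j ->
  diag_to e N \oc m = umap nu (fun x => pval (d x)) \oc diag_to e M ->
  m = pumap p.
Proof.
move=> /(diag_to_iso e N) ji E; apply: (iso_monoL ji).
by rewrite E (pumapE e d).
Qed.

Lemma pumap_germ_eq p q : germ_eq p q -> pumap p = pumap q.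
Proof.
case=> W mW H.
have dp (x : {i | W i}) : dom p (sval x) by case: (H _ (proj2_sig x)).
have dq (x : {i | W i}) : dom q (sval x) by case: (H _ (proj2_sig x)) => u [].
refine (pumap_uniq (e := push_trace mW) (d := dq) _ _).
  exact: sval_injective.
rewrite (pumapE (push_trace mW) dp); congr (_ \oc _).
apply: eq_umap => x; have [u [v E]] := H _ (proj2_sig x).
by rewrite (Prop_irrelevance (dp x) u) E (Prop_irrelevance v (dq x)).
Qed.

Lemma umap_germE p : umap_germ (germ p) = pumap p.
Proof.
rewrite /umap_germ; case: cid => q /= E.
by apply: pumap_germ_eq; apply: germ_eq_sym; rewrite E; exact: germ_eq_refl.
Qed.

Lemma pumap_total (g : forall i, hom (M i) (N i)) :
  pumap (total mu g) = umap mu g.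
Proof.
symmetry.
refine (@pumap_uniq (total mu g) I mu (fun i => i) erefl (fun=> Logic.I) _ _ _).
  by [].
by rewrite /= !diag_id comp_idl comp_idr.
Qed.

End Pumap.

Lemma pumap_comp I (mu : ultrafilter I) (M N P : I -> B)
    (q : pfam mu (fun i => hom (N i) (P i)))
    (p : pfam mu (fun i => hom (M i) (N i)))
    (r : pfam mu (fun i => hom (M i) (P i))) :
  (forall i (w : dom r i), exists (u : dom p i) (v : dom q i),
    pval w = pval v \oc pval u) ->
  pumap r = pumap q \oc pumap p.
Proof.
move=> H; pose J := {i | dom r i}; pose e := push_trace (dom_mem r).
have dp (x : J) : dom p (sval x) by case: (H _ (proj2_sig x)).
have dq (x : J) : dom q (sval x) by case: (H _ (proj2_sig x)) => u [].
symmetry; refine (pumap_uniq (e := e) (d := fun x => proj2_sig x) _ _).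
  exact: sval_injective.
rewrite comp_assoc (pumapE e dq) -comp_assoc (pumapE e dp) comp_assoc.
rewrite -umap_comp; congr (_ \oc _); apply: eq_umap => x.
have [u [v ->]] := H _ (proj2_sig x).
by rewrite (Prop_irrelevance (dp x) u) (Prop_irrelevance (dq x) v).
Qed.

Lemma pumap_map I (mu : ultrafilter I) (M N P : I -> B)
    (f : forall i, hom (N i) (P i)) (p : pfam mu (fun i => hom (M i) (N i))) :
  pumap (pfam_map (fun i (g : hom (M i) (N i)) => f i \oc g) p) =
  umap mu f \oc pumap p.
Proof.
rewrite -pumap_total; apply: pumap_comp => i u.
by exists u, Logic.I.
Qed.

Lemma pumap_pull I J (f : J -> I) (mu : ultrafilter J) (M N : I -> B)
    (p : pfam (push f mu) (fun i => hom (M i) (N i))) :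
  diag mu f N \oc pumap p = pumap (pfam_pull p) \oc diag mu f M.
Proof.
pose e := push_trace (dom_mem (pfam_pull p)).
have e' : push (fun x => f (sval x)) (trace (dom_mem (pfam_pull p))) =
  push f mu by rewrite -[X in push f X]e.
have I1 : is_iso (diag_to e (fun j => N (f j))).
  by apply: diag_to_iso; exact: sval_injective.
apply: (iso_monoL I1); rewrite [RHS]comp_assoc.
rewrite (@pumapE _ _ _ _ (pfam_pull p) _ _ _ e (fun x => proj2_sig x)).
have E (L : I -> B) : diag_to e (fun j => L (f j)) \oc diag mu f L =
    diag_to e' L := diag_to_comp (f := f) erefl e e' L.
rewrite [LHS]comp_assoc E -[RHS]comp_assoc E.
exact: (pumapE (p := p) e' (fun x => proj2_sig x)).
Qed.

Lemma pumap_along I J (mu : ultrafilter I) (nu : ultrafilter J) (f : J -> I)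
    (e : push f nu = mu) (M N : I -> B)
    (p : pfam mu (fun i => hom (M i) (N i)))
    (q : pfam nu (fun j => hom (M (f j)) (N (f j)))) :
  (forall j (w : dom q j), exists u : dom p (f j), pval w = pval u) ->
  diag_to e N \oc pumap p = pumap q \oc diag_to e M.
Proof.
case: _ / e p => p H /=; rewrite pumap_pull; congr (_ \oc _).
apply: pumap_germ_eq; exists (dom q) => [|j w]; first exact: dom_mem.
by have [u E] := H j w; exists u, w.
Qed.

Lemma assoc_nat I (X : I -> Type) (mu : ultrafilter I)
    (lam : forall i, ultrafilter (X i)) (M N : coprod X -> B)
    (g : forall p, hom (M p) (N p)) :
  colax_assoc mu lam N \oc umap (dsum mu lam) g =
  umap mu (fun i => umap (lam i) (fun x => g (inj i x))) \oc
    colax_assoc mu lam M.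
Proof.
rewrite /colax_assoc -comp_assoc.
rewrite (Delta_nat mu (fun i => push (inj i) (lam i)) g).
rewrite !comp_assoc -!umap_comp; congr (_ \oc _).
by apply: eq_umap => i; exact: diag_nat.
Qed.

Lemma assoc_Xir I (X K : I -> Type) (f : forall i, K i -> X i)
    (mu : ultrafilter I) (lam : forall i, ultrafilter (K i))
    (N : coprod X -> B) :
  let fbar (p : coprod K) : coprod X := inj (idx p) (f (idx p) (elt p)) in
  colax_assoc mu lam (fun p => N (fbar p)) \oc diag (dsum mu lam) fbar N =
  umap mu (fun i => diag (lam i) (f i) (fun x => N (inj i x))) \oc
    colax_assoc mu (fun i => push (f i) (lam i)) N.
Proof.
move=> fbar; rewrite /colax_assoc -comp_assoc.
rewrite (Delta_diag mu (fun i => push (inj i) (lam i)) fbar N).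
rewrite !comp_assoc -!umap_comp; congr (_ \oc _); apply: eq_umap => i.
rewrite (diag_comp (lam i) fbar (inj i) N).
by rewrite (diag_comp (lam i) (inj i) (f i) N).
Qed.

Lemma assoc_Xil I J (f : J -> I) (X : I -> Type) (mu : ultrafilter J)
    (lam : forall i, ultrafilter (X i)) (N : coprod X -> B) :
  let ftilde (p : coprod (fun j => X (f j))) : coprod X :=
    inj (f (idx p)) (elt p) in
  colax_assoc mu (fun j => lam (f j)) (fun p => N (ftilde p)) \oc
    diag (dsum mu (fun j => lam (f j))) ftilde N =
  diag mu f (fun i => uprod (lam i) (fun x => N (inj i x))) \oc
    colax_assoc (push f mu) lam N.
Proof.
move=> ft; rewrite /colax_assoc -comp_assoc.
rewrite (Delta_diag mu (fun j => push (inj j) (lam (f j))) ft N).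
rewrite !comp_assoc diag_nat -umap_comp -[RHS]comp_assoc.
rewrite (diag_Delta mu f (fun i => push (inj i) (lam i)) N).
congr (_ \oc _); apply: eq_umap => j.
exact: (diag_comp (lam (f j)) ft (inj j) N).
Qed.

Lemma assoc_pentagon I (X : I -> Type) (mu : ultrafilter I)
    (lam : forall i, ultrafilter (X i)) (T : coprod X -> Type)
    (L : coprod (fun i => coprod (fun x : X i => T (inj i x))) -> B)
    (om : forall p, ultrafilter (T p)) :
  let theta (q : coprod T) :
      coprod (fun i => coprod (fun x : X i => T (inj i x))) :=
    inj (idx (idx q)) (inj (elt (idx q)) (elt q)) in
  umap mu (fun i => colax_assoc (lam i) (fun x => om (inj i x))
    (fun p => L (inj i p))) \oc
    colax_assoc mu (fun i => dsum (lam i) (fun x => om (inj i x))) L =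
  colax_assoc mu lam
    (fun p => uprod (om p) (fun t => L (inj (idx p) (inj (elt p) t)))) \oc
  (colax_assoc (dsum mu lam) om (fun q => L (theta q)) \oc
   diag (dsum (dsum mu lam) om) theta L).
Proof.
move=> theta.
pose tau (p : coprod X) (t : T p) := theta (inj p t).
pose nu p := push (tau p) (om p).
transitivity (umap mu (fun i =>
    umap (lam i) (fun x => diag (om (inj i x)) (tau (inj i x)) L) \oc
    Delta (lam i) (fun x => nu (inj i x)) L) \oc
  Delta mu (fun i => uint (lam i) (fun x => nu (inj i x))) L).
  rewrite /(colax_assoc mu) comp_assoc -umap_comp; congr (_ \oc _).
  apply: eq_umap => i; rewrite /colax_assoc -comp_assoc.
  rewrite (Delta_diag (lam i) (fun x => push (inj x) (om (inj i x))) (inj i)).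
  rewrite comp_assoc -umap_comp; congr (_ \oc _); apply: eq_umap => x.
  exact: (diag_comp (om (inj i x)) (inj i) (inj x) L).
have -> : colax_assoc (dsum mu lam) om (fun q => L (theta q)) \oc
    diag (dsum (dsum mu lam) om) theta L =
    umap (dsum mu lam) (fun p => diag (om p) (tau p) L) \oc
    Delta (dsum mu lam) nu L.
  rewrite /colax_assoc -comp_assoc.
  rewrite (Delta_diag (dsum mu lam) (fun p => push (inj p) (om p)) theta L).
  rewrite comp_assoc -umap_comp; congr (_ \oc _); apply: eq_umap => p.
  exact: (diag_comp (om p) theta (inj p) L).
rewrite comp_assoc (assoc_nat mu lam (fun p => diag (om p) (tau p) L)).
rewrite umap_comp /colax_assoc -!comp_assoc; congr (_ \oc _).
have E := Delta_assoc mu (fun i => push (inj i) (lam i)) nu L.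
rewrite -[X in _ = _ \oc X]E comp_assoc -umap_comp; congr (_ \oc _).
apply: eq_umap => i; symmetry.
exact: (diag_Delta (lam i) (inj i) nu L).
Qed.

Lemma assoc_Xir_to I (X K : I -> Type) (f : forall i, K i -> X i)
    (mu : ultrafilter I) (lam : forall i, ultrafilter (X i))
    (ka : forall i, ultrafilter (K i))
    (e : forall i, push (f i) (ka i) = lam i)
    (fbar : coprod K -> coprod X := fun p => inj (idx p) (f (idx p) (elt p)))
    (e' : push fbar (dsum mu ka) = dsum mu lam) (N : coprod X -> B) :
  colax_assoc mu ka (fun p => N (fbar p)) \oc diag_to e' N =
  umap mu (fun i => diag_to (e i) (fun x => N (inj i x))) \oc
    colax_assoc mu lam N.
Proof.
have El : (fun i => push (f i) (ka i)) = lam.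
  exact: functional_extensionality_dep.
case: _ / El e e' => e e'.
rewrite (Prop_irrelevance e' erefl).
rewrite (_ : e = fun i => erefl); first exact: (assoc_Xir f mu ka N).
by apply: functional_extensionality_dep => i.
Qed.

Lemma assoc_Xil_to I J (f : J -> I) (X : I -> Type) (mu : ultrafilter I)
    (nu : ultrafilter J) (e : push f nu = mu)
    (lam : forall i, ultrafilter (X i)) (N : coprod X -> B)
    (ftilde : coprod (fun j => X (f j)) -> coprod X :=
      fun p => inj (f (idx p)) (elt p))
    (e' : push ftilde (dsum nu (fun j => lam (f j))) = dsum mu lam) :
  colax_assoc nu (fun j => lam (f j)) (fun p => N (ftilde p)) \oc
    diag_to e' N =
  diag_to e (fun i => uprod (lam i) (fun x => N (inj i x))) \oc
    colax_assoc mu lam N.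
Proof.
case: _ / e e' => e'; rewrite (Prop_irrelevance e' erefl).
exact: (assoc_Xil f nu lam N).
Qed.

Lemma assoc_pumap_total I (X : I -> Type) (M N : coprod X -> B)
    (mu : ultrafilter I) (lam : forall i, ultrafilter (X i))
    (h : pfam (dsum mu lam) (fun p => hom (M p) (N p)))
    (d : forall i, fiber_dom h i) :
  colax_assoc mu lam N \oc pumap h =
  umap mu (fun i => pumap (fiber (d i))) \oc colax_assoc mu lam M.
Proof.
pose K i := {x : X i | dom h (inj i x)}.
pose f i (x : K i) : X i := sval x.
pose ka i : ultrafilter (K i) := trace (d i).
have e i : push (f i) (ka i) = lam i by exact: push_trace.
pose fbar (p : coprod K) : coprod X := inj (idx p) (f (idx p) (elt p)).
have e' : push fbar (dsum mu ka) = dsum mu lam.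
  transitivity (dsum mu (fun i => push (f i) (ka i))) => //.
  by congr (dsum mu _); apply: functional_extensionality_dep.
have d' (p : coprod K) : dom h (fbar p) by exact: (proj2_sig (elt p)).
have I1 : is_iso (umap mu (fun i => diag_to (e i) (fun x => N (inj i x)))).
  by apply: umap_iso => i; apply: diag_to_iso; exact: sval_injective.
apply: (iso_monoL I1).
rewrite [LHS]comp_assoc -(assoc_Xir_to e e') -[LHS]comp_assoc.
rewrite (pumapE e' d') [LHS]comp_assoc.
rewrite (assoc_nat mu ka (fun p => pval (d' p))).
rewrite -[LHS]comp_assoc (assoc_Xir_to e e').
rewrite !comp_assoc -!umap_comp; congr (_ \oc _); apply: eq_umap => i.
by rewrite (pumapE (p := fiber (d i)) (e i) (fun x => d' (inj i x))).
Qed.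

Lemma assoc_pumap I (X : I -> Type) (M N : coprod X -> B)
    (mu : ultrafilter I) (lam : forall i, ultrafilter (X i))
    (h : pfam (dsum mu lam) (fun p => hom (M p) (N p))) :
  colax_assoc mu lam N \oc pumap h =
  pumap (@Pfam I mu _ (fiber_dom h) (fiber_dom_mem h)
    (fun i u => pumap (fiber u))) \oc colax_assoc mu lam M.
Proof.
pose J := {i | fiber_dom h i}.
pose nu : ultrafilter J := trace (fiber_dom_mem h).
pose f (j : J) : I := sval j.
have e : push f nu = mu by exact: push_trace.
pose ftilde (p : coprod (fun j => X (f j))) : coprod X :=
  inj (f (idx p)) (elt p).
have e' : push ftilde (dsum nu (fun j => lam (f j))) = dsum mu lam.
  exact: (congr1 (fun m => dsum m lam) e).
have I1 : is_iso (diag_to e (fun i => uprod (lam i) (fun x => N (inj i x)))).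
  by apply: diag_to_iso; exact: sval_injective.
apply: (iso_monoL I1).
pose q : pfam (dsum nu (fun j => lam (f j)))
    (fun p => hom (M (ftilde p)) (N (ftilde p))) :=
  @Pfam _ (dsum nu (fun j => lam (f j))) _ (ftilde @^-1` dom h)
    (eq_ind_r (fun m => uf_sets m (dom h)) (dom_mem h) e')
    (fun p (u : dom h (ftilde p)) => pval u).
have d (j : J) : fiber_dom q j by exact: (proj2_sig j).
rewrite [LHS]comp_assoc -(assoc_Xil_to e N e') -[LHS]comp_assoc.
rewrite (@pumap_along _ _ _ _ ftilde e' _ _ h q); last by move=> j w; exists w.
rewrite [LHS]comp_assoc (assoc_pumap_total d) -[LHS]comp_assoc.
rewrite (assoc_Xil_to e M e') [RHS]comp_assoc.
rewrite (pumapE e (p := Pfam _ _) (fun j => proj2_sig j)) -comp_assoc.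
congr (_ \oc _); apply: eq_umap => j /=.
apply: pumap_germ_eq; exists (dom (fiber (d j))); first exact: d.
by move=> x w; exists w, w.
Qed.

End UltracategoryTheory.

Section Canonical.
Variables (B : ultracategory) (HB : assoc_invertible B).

Definition canonical_data : gen_data :=
  @GenData B (fun A I M mu => hom A (uprod mu M))
    (fun A I M mu X N lam f g =>
      iso_inv (HB mu lam N) \oc (umap_germ g \oc f))
    (fun A I J f M mu h => diag mu f M \oc h)
    (fun A => iso_inv (eps_iso tt (fun _ : unit => A))).

Program Definition canonical_gen_ultracategory : gen_ultracategory :=
  @GenUltracategory canonical_data _ _ _ _ _ _ _ _.
Next Obligation. by move=> A I M mu h /=; rewrite diag_id comp_idl. Qed.
Next Obligation.
move=> A I J f M mu f_inj /=.
have [g [gf fg]] := diag_iso mu M f_inj.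
by exists (fun h => g \oc h) => h /=; rewrite comp_assoc ?gf ?fg comp_idl.
Qed.
Next Obligation.
by move=> A I J K f g M mu h /=; rewrite comp_assoc diag_comp.
Qed.
Next Obligation.
move=> A I M mu N b Xi.
have Da : eps tt (fun _ : unit => uprod mu M) \oc
    colax_assoc star (fun _ => mu) N = diag mu (inj tt) N.
  rewrite /colax_assoc comp_assoc.
  rewrite (eps_nat tt (fun s : unit => diag mu (inj s) N)) -comp_assoc.
  by rewrite (eps_Delta tt (fun s : unit => push (inj s) mu) N) comp_idr.
have bE h : b h = iso_inv (HB star (fun _ : unit => mu) N) \oc
    (iso_inv (eps_iso tt (fun _ : unit => uprod mu M)) \oc h).
  rewrite /b /= umap_germE pumap_total; congr (_ \oc _).
  apply: (iso_monoL (eps_iso tt _)).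
  rewrite [LHS]comp_assoc (eps_nat tt (fun _ : unit => h)) -[LHS]comp_assoc.
  by rewrite [RHS]comp_assoc !iso_invVK comp_idl comp_idr.
have XE k : Xi k = diag mu (inj tt) N \oc k by [].
split=> h; rewrite bE XE -Da.
  by apply: comp_isoVKK; exact: iso_invVK.
by apply: comp_isoKK; exact: iso_invK.
Qed.
Next Obligation.
move=> A I M mu N b Xi.
pose k i := iso_inv (eps_iso tt (fun _ : unit => M i)).
have Da : umap mu (fun i => eps tt (fun _ : unit => M i)) \oc
    colax_assoc mu (fun _ => star) N = diag mu (fun i => inj i tt) N.
  rewrite /colax_assoc comp_assoc -umap_comp; congr (_ \oc _).
  by apply: eq_umap => i; exact: (eps_diag tt (inj i) N).
have bE h : b h = iso_inv (HB mu (fun _ : I => star) N) \oc (umap mu k \oc h).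
  by rewrite /b /= umap_germE pumap_total.
have k1 : umap mu (fun i => eps tt (fun _ : unit => M i)) \oc umap mu k =
    idm _.
  by rewrite -umap_comp -umap_id; apply: eq_umap => i; exact: iso_invVK.
have k2 : umap mu k \oc umap mu (fun i => eps tt (fun _ : unit => M i)) =
    idm _.
  by rewrite -umap_comp -umap_id; apply: eq_umap => i; exact: iso_invK.
have XE x : Xi x = diag mu (fun i => inj i tt) N \oc x by [].
split=> h; rewrite bE XE -Da.
  exact: comp_isoVKK.
exact: comp_isoKK.
Qed.
Next Obligation.
move=> A I M mu X K f N lam h g fbar /=.
rewrite !umap_germE.
rewrite (pumap_map (fun i => diag (lam i) (f i) (fun x => N (inj i x)))).
apply: (iso_monoL (HB mu lam (fun p => N (fbar p)))).
rewrite [RHS]comp_assoc iso_invVK comp_idl.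
rewrite [LHS]comp_assoc (assoc_Xir f mu lam N).
rewrite comp_isoVK.
by rewrite comp_assoc.
Qed.
Next Obligation.
move=> A I J f M mu X N lam h g ftilde /=.
rewrite !umap_germE.
apply: (iso_monoL (HB mu (fun j => lam (f j)) (fun p => N (ftilde p)))).
rewrite [RHS]comp_assoc iso_invVK comp_idl.
rewrite [LHS]comp_assoc (assoc_Xil f mu lam N).
rewrite comp_isoVK.
rewrite [LHS]comp_assoc [RHS]comp_assoc; congr (_ \oc h).
exact: (pumap_pull (M := M)
  (N := fun i => uprod (lam i) (fun x => N (inj i x))) g).
Qed.
Next Obligation.
move=> A I M mu X N lam T L om f g h theta gh.
pose N' p := uprod (om p) (fun t => L (inj (idx p) (inj (elt p) t))).
pose r : pfam mu (fun i => hom (uprod (lam i) (fun x => N (inj i x)))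
    (uprod (lam i) (fun x => N' (inj i x)))) :=
  @Pfam I mu _ (fiber_dom h) (fiber_dom_mem h) (fun i u => pumap (fiber u)).
pose a i := colax_assoc (lam i) (fun x => om (inj i x)) (fun p => L (inj i p)).
pose a' i := iso_inv (HB (lam i) (fun x => om (inj i x))
  (fun p => L (inj i p))).
have ghE : pumap gh = umap mu a' \oc (pumap r \oc pumap g).
  rewrite comp_assoc -(pumap_map a' r).
  apply: pumap_comp => i w; exists (proj1 w), (proj2 w) => /=.
  by rewrite umap_germE comp_assoc.
have aa' : umap mu a \oc umap mu a' = idm _.
  by rewrite -umap_comp -umap_id; apply: eq_umap => i; exact: iso_invVK.
rewrite /= !umap_germE ghE.
apply: (iso_monoL (HB (dsum mu lam) om (fun q => L (theta q)))).
rewrite [RHS]comp_assoc iso_invVK comp_idl.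
apply: (iso_monoL (HB mu lam N')).
rewrite [RHS]comp_assoc (assoc_pumap h) -[RHS]comp_assoc.
rewrite [X in _ = _ \oc X]comp_assoc iso_invVK comp_idl.
rewrite (comp_assoc (colax_assoc (dsum mu lam) om (fun q => L (theta q)))).
rewrite [LHS]comp_assoc -(assoc_pentagon mu lam L om) comp_isoVK.
rewrite [X in _ \oc X = _](_ : _ =
  umap mu a' \oc (pumap r \oc (pumap g \oc f))).
  by rewrite [LHS]comp_assoc aa' comp_idl.
by rewrite -[LHS]comp_assoc -[X in _ \oc X = _]comp_assoc.
Qed.

End Canonical.

(* Main.v *)
From mathcomp Require Import all_boot.
From mathcomp Require Import boolp.
Require Import Defs.

Set Implicit Arguments.
Unset Strict Implicit.
Unset Printing Implicit Defensive.

(** Write [kappa] for the inverse of [eps] over the one-point ultrafilter.  In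
    the canonical structure [Hom(A, int M dmu)] is a set of morphisms of the
    ultracategory, and all composition is encoded by [beta], up to
    reindexing along the bijections [I = coprod_* I] and [I = coprod_I *]:

    - [h o f = Xi (beta (kappa o f, [h]))]  ([Xi_beta_star]);
    - [(int g_i dmu) o h = Xi (beta (h, [kappa o g_i]))]
      ([Xi_beta_pointwise]).

    Hence anything that preserves [beta], [Xi] and [kappa] is determined by
    very little.  A left ultrafunctor [(F, sigma)] gives
    [zeta h = sigma o F h]; this respects [beta] because [sigma] commutes with
    the colax associator ([sigma_assoc]) and with ultraproducts of germs
    ([sigma_pumap]).  Conversely, from [zeta] one reads off
    [sigma = zeta (id)] and [F f = eps o zeta (kappa o f)].  The two encodings
    above turn preservation of [beta] into [zeta (h o f) = zeta h o F f]
    ([canon_zeta_comp]), which is functoriality and also says that [zeta] is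
    recovered as [sigma o F], and into naturality of [sigma]
    ([canon_zeta_umap]).  The compatibility of [sigma] with the Fubini
    transform comes from the identity [Delta = a o Delta_pr], where [pr] is
    the projection [coprod_S T -> T] ([assoc_diag_elt]): it gives
    [beta (Delta, [id]) = Delta_pr], so that applying [zeta] to both sides
    gives the required equation.

    On transformations, [n] goes to the pair [alpha1 h = (int n dmu) o h] and
    [alpha2 h = h o n].  The same encodings show that every 2-morphism has
    this form, [n] being [eps o alpha1 (kappa)]: linearity of [alpha1] in the
    last variable of [beta] and of [alpha2] in the first one determine them
    by their values on [kappa], and these agree by the equation relating
    [alpha1] and [alpha2].

    The assignment [(F, sigma) |-> zeta] is thus a functor that is bijective on
    objects and on morphisms, which is the same as an isomorphism of
    categories ([bijective_functor_isomorphic]). *)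

(** * Strict isomorphisms of categories *)

Section StrictIsomorphisms.

(** Strict equality of functors forces equality of objects that need not be
    definitional; morphisms are compared across it by this transport. *)
Definition hom_cast (C : category) (A A' B B' : C) (eA : A = A') (eB : B = B')
    (f : hom A B) : hom A' B' :=
  match eA in _ = X, eB in _ = Y return hom X Y with erefl, erefl => f end.

Lemma functor_eq (C D : category) (F G : functor C D)
    (e : forall A, F A = G A) :
  (forall A B (f : hom A B), hom_cast (e A) (e B) (fhom F f) = fhom G f) ->
  F = G.
Proof.
case: F G e => o fh p q [o' fh' p' q'] /= e H.
have E : o = o' by exact: funext.
case: _ / E fh' p' q' e H => fh' p' q' e H.
have Efh : fh = fh'.
  apply: functional_extensionality_dep => A.
  apply: functional_extensionality_dep => B; apply: funext => f.
  by rewrite -H (Prop_irrelevance (e A) erefl) (Prop_irrelevance (e B) erefl).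
case: _ / Efh p' q' {H} => p' q'.
by rewrite (Prop_irrelevance p p') (Prop_irrelevance q q').
Qed.

Lemma hom_cast_idm (C : category) (A A' : C) (e : A = A') :
  hom_cast e e (idm A) = idm A'.
Proof. by case: _ / e. Qed.

Lemma hom_cast_comp (C : category) (A A' B B' D D' : C) (eA : A = A')
    (eB : B = B') (eD : D = D') (g : hom B D) (f : hom A B) :
  hom_cast eA eD (g \oc f) = hom_cast eB eD g \oc hom_cast eA eB f.
Proof. by case: _ / eA; case: _ / eB; case: _ / eD. Qed.

Lemma hom_castK (C : category) (A A' B B' : C) (eA : A = A') (eB : B = B')
    (eA' : A' = A) (eB' : B' = B) (f : hom A B) :
  hom_cast eA' eB' (hom_cast eA eB f) = f.
Proof.
case: _ / eA eA'; case: _ / eB eB' => eB eA.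
by rewrite (Prop_irrelevance eA erefl) (Prop_irrelevance eB erefl).
Qed.

Lemma fhom_cast (C D : category) (F : functor C D) (A A' B B' : C)
    (eA : A = A') (eB : B = B') (f : hom A B) :
  fhom F (hom_cast eA eB f) =
  hom_cast (congr1 (fob F) eA) (congr1 (fob F) eB) (fhom F f).
Proof. by case: _ / eA; case: _ / eB. Qed.

(** The inverse on morphisms is conjugated by the identifications
    [F (g X) = X].  Its functoriality is checked after applying [F], which is
    injective on morphisms. *)
Lemma bijective_functor_isomorphic (C D : category) (F : functor C D) :
  bijective (fob F) -> (forall A B, bijective (@fhom C D F A B)) ->
  isomorphic_categories C D.
Proof.
case=> g Fg gF Fbij.
pose k A B : hom (F A) (F B) -> hom A B :=
  projT1 (cid (let: Bijective k K1 K2 := Fbij A B in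
    ex_intro (fun k => cancel (@fhom C D F A B) k /\ cancel k (@fhom C D F A B))
      k (conj K1 K2))).
have kF A B : cancel (@fhom C D F A B) (@k A B).
  by rewrite /k; case: cid => ? [].
have Fk A B : cancel (@k A B) (@fhom C D F A B).
  by rewrite /k; case: cid => ? [].
have Finj A B : injective (@fhom C D F A B) := can_inj (kF A B).
pose gh X Y (f : hom X Y) : hom (g X) (g Y) :=
  k _ _ (hom_cast (esym (gF X)) (esym (gF Y)) f).
have gh1 X : gh _ _ (idm X) = idm (g X).
  by apply: Finj; rewrite Fk hom_cast_idm fhom_id.
have ghM X Y Z (v : hom Y Z) (u : hom X Y) :
    gh _ _ (v \oc u) = gh _ _ v \oc gh _ _ u.
  apply: Finj; rewrite fhom_comp !Fk.
  exact: hom_cast_comp.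
pose G := @Functor D C g gh gh1 ghM.
exists F, G; split.
  apply: (@functor_eq C C (functor_comp G F) (functor_id C) Fg) => A B f /=.
  by apply: Finj; rewrite fhom_cast Fk hom_castK.
apply: (@functor_eq D D (functor_comp F G) (functor_id D) gF) => X Y f /=.
by rewrite Fk hom_castK.
Qed.

End StrictIsomorphisms.

(** * Composition in terms of the generalised structure *)

Section CanonicalComposition.
Variables (B : ultracategory) (HB : assoc_invertible B).
Local Notation C := (canonical_gen_ultracategory HB).
Local Notation kap A := (iso_inv (eps_iso tt (fun _ : unit => A))).

(** The next two lemmas identify the colax associator, when one of the two
    levels of the coproduct is a point, with reindexing along the bijections
    of the unit axioms; this is how the inverse associator hidden in [beta]
    cancels. *)
Lemma eps_assoc I (mu : ultrafilter I) (N : coprod (fun _ : unit => I) -> B) :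
  eps tt (fun u => uprod mu (fun i => N (inj u i))) \oc
    colax_assoc star (fun _ => mu) N = diag mu (inj tt) N.
Proof.
rewrite /colax_assoc comp_assoc.
rewrite (eps_nat tt (fun s : unit => diag mu (inj s) N)) -comp_assoc.
by rewrite (eps_Delta tt (fun s : unit => push (inj s) mu) N) comp_idr.
Qed.

Lemma umap_eps_assoc I (mu : ultrafilter I)
    (N : coprod (fun _ : I => unit) -> B) :
  umap mu (fun i => eps tt (fun u => N (inj i u))) \oc
    colax_assoc mu (fun _ => star) N = diag mu (fun i => inj i tt) N.
Proof.
rewrite /colax_assoc comp_assoc -umap_comp; congr (_ \oc _).
by apply: eq_umap => i; exact: (eps_diag tt (inj i) N).
Qed.

(** With [k = kappa o f] the right-hand side is [h o f]; the general form also
    applies to [k = zeta (kappa o f)]. *)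
Lemma Xi_beta_star I (mu : ultrafilter I) (M : I -> B) (A P : B)
    (k : hom A (uprod star (fun _ => P))) (h : hom P (uprod mu M)) :
  @gXi C A _ _ (inj tt) (fun p : coprod (fun _ : unit => I) => M (elt p)) mu
    (@gbeta C A _ (fun _ => P) star (fun _ => I) (fun p => M (elt p))
      (fun _ => mu) k (germ (total star (fun _ => h)))) =
  h \oc (eps tt (fun _ : unit => P) \oc k).
Proof.
pose N (p : coprod (fun _ : unit => I)) := M (elt p).
rewrite /= umap_germE pumap_total -(eps_assoc mu N) comp_isoVK.
rewrite [RHS]comp_assoc [LHS]comp_assoc; congr (_ \oc _).
exact: (eps_nat tt (fun _ : unit => h)).
Qed.

Lemma Xi_beta_pointwise I (mu : ultrafilter I) (P M : I -> B) (A : B)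
    (k : hom A (uprod mu P))
    (g : forall i, hom (P i) (uprod star (fun _ => M i))) :
  @gXi C A _ _ (fun i => inj i tt)
    (fun p : coprod (fun _ : I => unit) => M (idx p)) mu
    (@gbeta C A _ P mu (fun _ => unit) (fun p => M (idx p))
      (fun _ => star) k (germ (total mu g))) =
  umap mu (fun i => eps tt (fun _ : unit => M i) \oc g i) \oc k.
Proof.
pose N (p : coprod (fun _ : I => unit)) := M (idx p).
rewrite /= umap_germE pumap_total -(umap_eps_assoc mu N) comp_isoVK.
by rewrite comp_assoc -umap_comp.
Qed.

(** Every Fubini transform is a diagonal map followed by an associator.  This
    holds since the projection restricts to the identity on each summand, and
    it expresses [Delta] by operations that [zeta] preserves. *)
Lemma assoc_diag_elt S T (mu : ultrafilter S) (nu : S -> ultrafilter T)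
    (M : T -> B) :
  colax_assoc mu nu (fun p : coprod (fun _ : S => T) => M (elt p)) \oc
    diag (dsum mu nu) elt M = Delta mu nu M.
Proof.
rewrite /colax_assoc -comp_assoc.
rewrite (Delta_diag mu (fun s => push (@inj S (fun _ => T) s) (nu s)) elt M).
rewrite comp_assoc -umap_comp -[RHS]comp_idl -umap_id; congr (_ \oc _).
apply: eq_umap => s; transitivity (diag (nu s) (fun t => t) M).
  exact: (@diag_comp B T (coprod (fun _ : S => T)) T (nu s) elt (inj s) M).
exact: diag_id.
Qed.

Lemma eps_kap_comp (A P : B) (f : hom A P) :
  eps tt (fun _ : unit => P) \oc (kap P \oc f) = f.
Proof. by rewrite comp_assoc iso_invVK comp_idl. Qed.

End CanonicalComposition.

(** * Compatibility of a left ultrafunctor with the derived structure *)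

Section SigmaCompatibility.
Variables (B B' : ultracategory) (F : left_ultrafunctor B B').

(** The diagonal map is built from [Delta] and [eps], so each of the two axioms
    of [sigma] handles one factor; the same pattern gives [sigma_assoc]. *)
Lemma sigma_diag S T (mu : ultrafilter S) (f : S -> T) (M : T -> B) :
  diag mu f (fun t => F (M t)) \oc sigma F (push f mu) M =
  sigma F mu (fun s => M (f s)) \oc fhom F (diag mu f M).
Proof.
rewrite /diag -comp_assoc.
rewrite (sigma_Delta F mu (fun s => principal (f s)) M).
rewrite !comp_assoc -umap_comp fhom_comp comp_assoc.
rewrite (sigma_nat F mu (fun s => eps (f s) M)); congr (_ \oc _ \oc _).
by apply: eq_umap => s; exact: sigma_eps.
Qed.

Lemma sigma_diag_to I J (mu : ultrafilter I) (nu : ultrafilter J) (f : J -> I)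
    (e : push f nu = mu) (M : I -> B) :
  diag_to e (fun i => F (M i)) \oc sigma F mu M =
  sigma F nu (fun j => M (f j)) \oc fhom F (diag_to e M).
Proof. by case: _ / e; exact: sigma_diag. Qed.

Lemma sigma_assoc I (X : I -> Type) (mu : ultrafilter I)
    (lam : forall i, ultrafilter (X i)) (N : coprod X -> B) :
  colax_assoc mu lam (fun p => F (N p)) \oc sigma F (dsum mu lam) N =
  umap mu (fun i => sigma F (lam i) (fun x => N (inj i x))) \oc
    sigma F mu (fun i => uprod (lam i) (fun x => N (inj i x))) \oc
    fhom F (colax_assoc mu lam N).
Proof.
rewrite /colax_assoc -[LHS]comp_assoc.
rewrite [X in _ \oc X = _](sigma_Delta F mu (fun i => push (inj i) (lam i)) N).
rewrite fhom_comp !comp_assoc -umap_comp; congr (_ \oc _).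
rewrite -[RHS]comp_assoc (sigma_nat F mu (fun i => diag (lam i) (inj i) N)).
rewrite comp_assoc -umap_comp; congr (_ \oc _).
by apply: eq_umap => i; exact: sigma_diag.
Qed.

(** Naturality of [sigma] for families that are only defined almost everywhere:
    such an ultraproduct is computed on the domain of definition, to which
    [sigma] can be restricted by [sigma_diag_to]. *)
Lemma sigma_pumap I (mu : ultrafilter I) (M N : I -> B)
    (p : pfam mu (fun i => hom (M i) (N i))) :
  sigma F mu N \oc fhom F (pumap p) =
  pumap (pfam_map (fun i (g : hom (M i) (N i)) => fhom F g) p) \oc
    sigma F mu M.
Proof.
pose q := pfam_map (fun i (g : hom (M i) (N i)) => fhom F g) p.
pose e := push_trace (dom_mem p).
have I1 : is_iso (diag_to e (fun i => F (N i))).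
  by apply: diag_to_iso; exact: sval_injective.
apply: (iso_monoL I1).
rewrite [LHS]comp_assoc sigma_diag_to -[LHS]comp_assoc -fhom_comp.
rewrite (pumapE e (p := p) (fun x => proj2_sig x)) fhom_comp [LHS]comp_assoc.
rewrite (sigma_nat F _ (fun u : {i | dom p i} => pval (proj2_sig u))).
rewrite -[LHS]comp_assoc -sigma_diag_to [LHS]comp_assoc [RHS]comp_assoc.
by rewrite (pumapE e (p := q) (fun x => proj2_sig x)).
Qed.

Lemma eps_sigma (A P : B) (f : hom A P) :
  eps tt (fun _ : unit => F P) \oc
    (sigma F star (fun _ => P) \oc
      fhom F (iso_inv (eps_iso tt (fun _ : unit => P)) \oc f)) = fhom F f.
Proof.
rewrite comp_assoc (sigma_eps F tt (fun _ : unit => P)) -fhom_comp.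
by rewrite eps_kap_comp.
Qed.

End SigmaCompatibility.

(** * Extensionality of left ultrafunctors *)

Lemma left_ultrafunctor_eq (B B' : ultracategory) (o : B -> B')
    (fh fh' : forall A P : B, hom A P -> hom (o A) (o P))
    (s s' : forall (I : Type) (mu : ultrafilter I) (M : I -> B),
      hom (o (uprod mu M)) (uprod mu (fun i => o (M i))))
    p q p' q' s1 s2 s3 s1' s2' s3' :
  (forall A P (f : hom A P), fh A P f = fh' A P f) ->
  (forall I mu M, s I mu M = s' I mu M) ->
  @LeftUltrafunctor B B' (@Functor B B' o fh p q) s s1 s2 s3 =
  @LeftUltrafunctor B B' (@Functor B B' o fh' p' q') s' s1' s2' s3'.
Proof.
move=> Efh Es.
have E : fh = fh'.
  by do ![apply: functional_extensionality_dep => ?]; exact: Efh.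
case: _ / E p' q' s1' s2' s3' {Efh} => p' q'.
have E : s = s'.
  by do ![apply: functional_extensionality_dep => ?]; exact: Es.
rewrite (Prop_irrelevance p' p) (Prop_irrelevance q' q).
case: _ / E {Es} => s1' s2' s3'.
by rewrite (Prop_irrelevance s1 s1') (Prop_irrelevance s2 s2')
  (Prop_irrelevance s3 s3').
Qed.

Lemma gen_left_ultrafunctor_eq (C C' : gen_ultracategory) (o : C -> C')
    (z z' : forall (A : C) I (M : I -> C) (mu : ultrafilter I),
      ghom A M mu -> ghom (o A) (fun i => o (M i)) mu) p q r p' q' r' :
  (forall A I M mu h, z A I M mu h = z' A I M mu h) ->
  @GenLeftUltrafunctor C C' o z p q r = @GenLeftUltrafunctor C C' o z' p' q' r'.
Proof.
move=> Ez; have E : z = z'.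
  by do ![apply: functional_extensionality_dep => ?]; exact: Ez.
case: _ / E p' q' r' {Ez} => p' q' r'.
by rewrite (Prop_irrelevance p p') (Prop_irrelevance q q')
  (Prop_irrelevance r r').
Qed.

(** * From left ultrafunctors to generalised left ultrafunctors *)

Section Isomorphism.
Variables (B B' : ultracategory).
Variables (hB : assoc_invertible B) (hB' : assoc_invertible B').
Local Notation C := (canonical_gen_ultracategory hB).
Local Notation C' := (canonical_gen_ultracategory hB').
Local Notation kap A := (iso_inv (eps_iso tt (fun _ : unit => A))).

Program Definition gen_of_left (F : left_ultrafunctor B B') :
  gen_left_ultrafunctor C C' :=
  @GenLeftUltrafunctor C C' (fob F)
    (fun A I M mu h => sigma F mu M \oc fhom F h) _ _ _.
Next Obligation.
move=> F A I M mu X N lam h g /=; rewrite !umap_germE.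
apply: (iso_monoL (hB' mu lam (fun p => F (N p)))).
rewrite [RHS]comp_assoc iso_invVK comp_idl [LHS]comp_assoc sigma_assoc.
rewrite -[LHS]comp_assoc -fhom_comp comp_assoc iso_invVK comp_idl.
rewrite fhom_comp -[LHS]comp_assoc [X in _ \oc X = _]comp_assoc sigma_pumap.
rewrite -[X in _ \oc X = _]comp_assoc [LHS]comp_assoc; congr (_ \oc _).
symmetry; exact: (pumap_map (M := fun i => F (M i))
  (fun i => sigma F (lam i) (fun x => N (inj i x)))
  (pfam_map (fun i (k : hom (M i) _) => fhom F k) g)).
Qed.
Next Obligation.
move=> F A I J f M mu h /=.
by rewrite fhom_comp !comp_assoc sigma_diag.
Qed.
Next Obligation.
move=> F A /=; apply: (iso_monoL (eps_iso tt _)); rewrite iso_invVK comp_assoc.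
by rewrite (sigma_eps F tt (fun _ : unit => A)) -fhom_comp iso_invVK fhom_id.
Qed.

(** * Recovering a left ultrafunctor from its generalised version *)

Section Recovery.
Variable F : gen_left_ultrafunctor C C'.

(** [zeta] with its source and target typed as morphisms of [B] and [B'], so
    that it can be composed with other morphisms. *)
Definition canon_zeta (A : B) I (M : I -> B) (mu : ultrafilter I)
    (h : hom A (uprod mu M)) :
    hom (F A : B') (uprod mu (fun i => F (M i) : B')) :=
  @zeta C C' F A I M mu h.

(** Composition with [kappa] identifies the morphisms [A -> P] with the elements
    of [Hom(A, int P)] over the point, on which [zeta] acts. *)
Definition canon_fhom (A P : B) (f : hom A P) : hom (F A : B') (F P) :=
  eps tt (fun _ : unit => F P : B') \oc
    @canon_zeta A unit (fun _ => P) star (kap P \oc f).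

(** Encode [h o f] as [Xi (beta (kappa o f, [h]))], apply [zeta], and decode in
    [B']. *)
Lemma canon_zeta_comp (A P : B) I (M : I -> B) (mu : ultrafilter I)
    (h : hom P (uprod mu M)) (f : hom A P) :
  canon_zeta (h \oc f) = canon_zeta h \oc canon_fhom f.
Proof.
have E := Xi_beta_star hB (kap P \oc f) h.
rewrite eps_kap_comp in E.
rewrite -[in LHS]E /canon_zeta.
rewrite [LHS](zeta_Xi F (f := inj tt)).
have E' := @zeta_beta C C' F A unit (fun _ => P) star (fun _ => I)
  (fun p => M (elt p)) (fun _ => mu) (kap P \oc f) (total star (fun _ => h)).
etransitivity; first exact: (congr1 (@gXi C' (F A) _ _ (inj tt)
  (fun p : coprod (fun _ : unit => I) => F (M (elt p))) mu) E').
exact: (@Xi_beta_star B' hB' I mu (fun i => F (M i)) (F A) (F P) _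
  (canon_zeta h)).
Qed.

(** The same argument with the encoding [Xi (beta (k, [kappa o g_i]))]. *)
Lemma canon_zeta_umap (A : B) I (P M : I -> B) (mu : ultrafilter I)
    (g : forall i, hom (P i) (M i)) (k : hom A (uprod mu P)) :
  canon_zeta (umap mu g \oc k) =
  umap mu (fun i => canon_fhom (g i)) \oc canon_zeta k.
Proof.
have E := Xi_beta_pointwise hB k (fun i => kap (M i) \oc g i).
rewrite (eq_umap _ (fun i => eps_kap_comp (g i))) in E.
rewrite -[in LHS]E /canon_zeta.
rewrite [LHS](zeta_Xi F (f := fun i => inj i tt)).
have E' := @zeta_beta C C' F A I P mu (fun _ => unit)
  (fun p => M (idx p)) (fun _ => star) k
  (total mu (fun i => kap (M i) \oc g i)).
etransitivity; first exact: (congr1 (@gXi C' (F A) _ _ (fun i => inj i tt)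
  (fun p : coprod (fun _ : I => unit) => F (M (idx p))) mu) E').
exact: (@Xi_beta_pointwise B' hB' I mu (fun i => F (P i)) (fun i => F (M i))
  (F A) (canon_zeta k) (fun i => canon_zeta (kap (M i) \oc g i))).
Qed.

Lemma canon_zeta_diag (A : B) S T (mu : ultrafilter S) (f : S -> T) (M : T -> B)
    (h : hom A (uprod (push f mu) M)) :
  canon_zeta (diag mu f M \oc h) =
  diag mu f (fun t => F (M t) : B') \oc canon_zeta h.
Proof. exact: (@zeta_Xi C C' F A T S f M mu h). Qed.

Lemma canon_fhom_id (A : B) : canon_fhom (idm A) = idm (F A : B').
Proof.
rewrite /canon_fhom comp_idr [X in _ \oc X](zeta_kappa F A).
exact: iso_invVK.
Qed.

Lemma canon_fhom_comp (A P Q : B) (g : hom P Q) (f : hom A P) :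
  canon_fhom (g \oc f) = canon_fhom g \oc canon_fhom f.
Proof. by rewrite {1}/canon_fhom comp_assoc canon_zeta_comp comp_assoc. Qed.

(** This is what makes the two constructions mutually inverse: [zeta] is
    [sigma o F] for the recovered [sigma] and [F]. *)
Lemma canon_zetaE (A : B) I (M : I -> B) (mu : ultrafilter I)
    (h : hom A (uprod mu M)) :
  canon_zeta h = canon_zeta (idm (uprod mu M)) \oc canon_fhom h.
Proof. by rewrite -canon_zeta_comp comp_idl. Qed.

Definition underlying_functor : functor B B' :=
  @Functor B B' (fun A => F A) canon_fhom canon_fhom_id canon_fhom_comp.

Program Definition left_of_gen : left_ultrafunctor B B' :=
  @LeftUltrafunctor B B' underlying_functor
    (fun I mu M => canon_zeta (idm (uprod mu M))) _ _ _.
Next Obligation.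
by move=> I mu M N f /=; rewrite -canon_zetaE -canon_zeta_umap comp_idr.
Qed.
Next Obligation.
move=> I i0 M /=.
(* The counit at [i0] is reindexing along the point [i0], up to [kappa], and
   [zeta] preserves reindexing. *)
have E : kap (M i0) \oc eps i0 M = diag star (fun _ => i0) M.
  apply: (iso_monoL (eps_iso tt _)); rewrite eps_kap_comp.
  by symmetry; exact: (eps_diag tt (fun _ => i0) M).
have Ez : @canon_zeta _ unit (fun _ => M i0) star (kap (M i0) \oc eps i0 M) =
    diag star (fun _ => i0) (fun i => F (M i) : B') \oc canon_zeta (idm _).
  by rewrite E -[X in canon_zeta X]comp_idr; exact: canon_zeta_diag.
rewrite /canon_fhom Ez comp_assoc; congr (_ \oc _); symmetry.
exact: (@eps_diag B' unit I tt (fun _ => i0) (fun i => F (M i))).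
Qed.
Next Obligation.
move=> S T mu nu M /=.
pose N (p : coprod (fun _ : S => T)) := M (elt p).
pose ids s := idm (uprod (nu s) M).
have E := @zeta_beta C C' F _ S _ mu (fun _ => T) N nu (Delta mu nu M)
  (total mu ids).
(* By [assoc_diag_elt], [beta (Delta, [id])] is reindexing along the
   projection, so [zeta] can be evaluated on it in two ways. *)
have E1 : @gbeta C _ _ _ mu (fun _ => T) N nu (Delta mu nu M)
    (germ (total mu ids)) = diag (dsum mu nu) elt M \oc idm _.
  rewrite /= umap_germE pumap_total umap_id comp_idl comp_idr.
  by rewrite -(assoc_diag_elt mu nu M) comp_assoc iso_invK comp_idl.
pose N' p : B' := F (N p).
have E2 : diag (dsum mu nu) elt (fun t => F (M t) : B') \oc
    canon_zeta (idm (uprod (uint mu nu) M)) =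
    iso_inv (hB' mu nu N') \oc
      (umap mu (fun s => canon_zeta (ids s)) \oc canon_zeta (Delta mu nu M)).
  rewrite -[LHS](canon_zeta_diag (mu := dsum mu nu) (f := elt) (M := M)) -E1.
  refine (etrans E _); rewrite /= umap_germE.
  by rewrite -[X in _ = _ \oc (X \oc _)]pumap_total.
rewrite -[RHS]comp_assoc -canon_zetaE.
rewrite -(assoc_diag_elt mu nu (fun t => F (M t) : B')).
by rewrite -[LHS]comp_assoc E2 comp_assoc iso_invVK comp_idl.
Qed.

End Recovery.

(** * The bijection on objects *)

Lemma gen_of_leftK : cancel gen_of_left left_of_gen.
Proof.
move=> F.
have Eh := @eps_sigma B B' F.
have Es I mu (M : I -> B) : sigma F mu M \oc fhom F (idm _) = sigma F mu M.
  by rewrite fhom_id comp_idr.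
case: F Eh Es => -[o fh p q] s s1 s2 s3 Eh Es.
by apply: left_ultrafunctor_eq; [exact: Eh|exact: Es].
Qed.

Lemma left_of_genK : cancel left_of_gen gen_of_left.
Proof.
move=> F; have := @canon_zetaE F; case: F => o z p q r Ez.
apply: gen_left_ultrafunctor_eq => A I M mu h.
exact: (esym (Ez A I M mu h)).
Qed.

(** * The bijection on transformations *)

Program Definition gen_nat_of_left (F G : left_ultrafunctor B B')
    (n : left_ultra_nat F G) :
  gen_left_ultra_nat (gen_of_left F) (gen_of_left G) :=
  @GenLeftUltraNat C C' (gen_of_left F) (gen_of_left G)
    (fun A I M mu h => umap mu (fun i => n (M i)) \oc h)
    (fun A I M mu h => h \oc n A) _ _ _ _ _.
Next Obligation.
move=> F G n A I J f M mu h /=; rewrite [LHS]comp_assoc [RHS]comp_assoc.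
by rewrite (diag_nat mu f (fun i => n (M i))).
Qed.
Next Obligation. by move=> F G n A I J f M mu h /=; rewrite comp_assoc. Qed.
Next Obligation.
by move=> F G n A I M mu X N lam h g /=;
  rewrite -[LHS]comp_assoc -[X in _ \oc X = _]comp_assoc.
Qed.
Next Obligation.
move=> F G n A I M mu X N lam h g /=; rewrite !umap_germE.
apply: (iso_monoL (hB' mu lam (fun p => G (N p)))).
rewrite [LHS]comp_assoc (assoc_nat mu lam (fun p => n (N p))) comp_isoVK.
rewrite [RHS]comp_assoc iso_invVK comp_idl comp_assoc; congr (_ \oc _).
by rewrite -(pumap_map (fun i => umap (lam i) (fun x => n (N (inj i x))))).
Qed.
Next Obligation.
move=> F G n A I M mu h /=; rewrite comp_assoc ncomp_sigma.
by rewrite -!comp_assoc ncomp_nat.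
Qed.

Program Definition gen_functor :
  functor (left_ultrafunctor_category B B')
    (gen_left_ultrafunctor_category C C') :=
  @Functor (left_ultrafunctor_category B B')
    (gen_left_ultrafunctor_category C C') gen_of_left gen_nat_of_left _ _.
Next Obligation.
move=> F; apply: gen_left_ultra_nat_eq => /=;
  do ![apply: functional_extensionality_dep => ?].
  by rewrite umap_id comp_idl.
by rewrite comp_idr.
Qed.
Next Obligation.
move=> F G H b a; apply: gen_left_ultra_nat_eq => /=;
  do ![apply: functional_extensionality_dep => ?].
  by rewrite umap_comp comp_assoc.
by rewrite comp_assoc.
Qed.

Section RecoveryNat.
Variables (F G : left_ultrafunctor B B').
Variable a : gen_left_ultra_nat (gen_of_left F) (gen_of_left G).

Definition component (A : B) : hom (F A) (G A) :=
  eps tt (fun _ : unit => G A) \oc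
    @alpha1 _ _ _ _ a (F A) unit (fun _ => A) star (kap (F A)).

(** Write [h = Xi (beta (h, [kappa]))]; then [alpha1] acts on [kappa] only. *)
Lemma alpha1E (A : B') I (M : I -> B) (mu : ultrafilter I)
    (h : hom A (uprod mu (fun i => F (M i)))) :
  @alpha1 _ _ _ _ a A I M mu h = umap mu (fun i => component (M i)) \oc h.
Proof.
have E := Xi_beta_pointwise hB' h (fun i => kap (F (M i))).
rewrite (eq_umap _ (fun i => iso_invVK _)) umap_id comp_idl in E.
rewrite -[in LHS]E.
rewrite [LHS](alpha1_Xi a (f := fun i => inj i tt)
  (M := fun p : coprod (fun _ : I => unit) => M (idx p))).
have E' := @alpha1_beta _ _ _ _ a A I (fun i => F (M i)) mu
  (fun _ => unit) (fun p => M (idx p)) (fun _ => star) h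
  (total mu (fun i => kap (F (M i)))).
refine (etrans (congr1 (@gXi C' A _ _ (fun i => inj i tt)
  (fun p : coprod (fun _ : I => unit) => G (M (idx p))) mu) E') _).
exact: (@Xi_beta_pointwise B' hB' I mu (fun i => F (M i)) (fun i => G (M i))
  A h (fun i => @alpha1 _ _ _ _ a _ unit (fun _ => M i) star (kap (F (M i))))).
Qed.

(** Write [h = Xi (beta (kappa, [h]))]; then [alpha2] acts on [kappa] only. *)
Lemma alpha2E (A : B) I (M : I -> B') (mu : ultrafilter I)
    (h : hom (G A) (uprod mu M)) :
  @alpha2 _ _ _ _ a A I M mu h = h \oc component A.
Proof.
have E := Xi_beta_star hB' (kap (G A)) h.
rewrite iso_invVK comp_idr in E.
rewrite -[in LHS]E.
rewrite [LHS](alpha2_Xi a (f := inj tt)).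
have E' := @alpha2_beta _ _ _ _ a A unit (fun _ => G A) star (fun _ => I)
  (fun p => M (elt p)) (fun _ => mu) (kap (G A)) (total star (fun _ => h)).
refine (etrans (congr1 (@gXi C' (F A) _ _ (inj tt)
  (fun p : coprod (fun _ : unit => I) => M (elt p)) mu) E') _).
(* [kappa] is preserved by both functors, so the relation between [alpha1] and
   [alpha2] identifies their values there. *)
have Ek : @alpha2 _ _ _ _ a A unit (fun _ => G A) star (kap (G A)) =
    @alpha1 _ _ _ _ a (F A) unit (fun _ => A) star (kap (F A)).
  have := @alpha_zeta _ _ _ _ a A unit (fun _ => A) star (kap A).
  rewrite (zeta_kappa (gen_of_left F) A) (zeta_kappa (gen_of_left G) A).
  by move=> ->.
rewrite Ek.
exact: (@Xi_beta_star B' hB' I mu M (F A) (G A)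
  (@alpha1 _ _ _ _ a (F A) unit (fun _ => A) star (kap (F A))) h).
Qed.

Program Definition left_nat_of_gen : left_ultra_nat F G :=
  @LeftUltraNat B B' F G component _ _.
Next Obligation.
move=> A P f.
have := @alpha_zeta _ _ _ _ a A unit (fun _ => P) star (kap P \oc f).
rewrite alpha1E alpha2E /=.
move/(congr1 (fun k => eps tt (fun _ : unit => G P) \oc k)).
rewrite [LHS]comp_assoc.
rewrite [X in X \oc _ = _](eps_nat tt (fun _ : unit => component P)).
by rewrite -[LHS]comp_assoc eps_sigma [RHS]comp_assoc eps_sigma => ->.
Qed.
Next Obligation.
move=> I mu M.
have := @alpha_zeta _ _ _ _ a _ I M mu (idm _).
by rewrite alpha1E alpha2E /= !fhom_id !comp_idr.
Qed.

End RecoveryNat.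

Lemma gen_nat_of_left_bij (F G : left_ultrafunctor B B') :
  bijective (@gen_nat_of_left F G).
Proof.
exists (@left_nat_of_gen F G) => [n|a].
  apply: left_ultra_nat_eq => A /=; rewrite /component /=.
  by rewrite comp_assoc (eps_nat tt (fun _ : unit => n A)) -comp_assoc
    iso_invVK comp_idr.
apply: gen_left_ultra_nat_eq => /=;
  do ![apply: functional_extensionality_dep => ?].
  by rewrite alpha1E.
by rewrite alpha2E.
Qed.

End Isomorphism.

Theorem theorem5p9 (B B' : ultracategory)
    (hB : assoc_invertible B) (hB' : assoc_invertible B') :
  isomorphic_categories
    (left_ultrafunctor_category B B')
    (gen_left_ultrafunctor_category
      (canonical_gen_ultracategory hB) (canonical_gen_ultracategory hB')).
Proof.
apply: (bijective_functor_isomorphic (F := gen_functor hB hB')).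
  exists (@left_of_gen B B' hB hB'); [exact: gen_of_leftK|].
  exact: left_of_genK.
exact: gen_nat_of_left_bij.
Qed.
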